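(* Let $r>2$, let $p(z_1,z_2)=1-\frac{z_1+z_2}{r}$, and let $c_{k_1,k_2}=\frac{1}{4\pi^2}\int_0^{2\pi}\!\int_0^{2\pi}\frac{e^{-i(k_1\theta_1+k_2\theta_2)}}{|p(e^{i\theta_1},e^{i\theta_2})|^2}d\theta_1d\theta_2$. Let $k_1\ge k_2>0$ be integers and let $t\to\infty$ through the positive integers. Then: (i) if $\frac{(k_1+k_2)^2}{r^2k_1k_2}<1$, $$\lim_{t\to\infty}\sqrt t\left(\frac{r^{k_1+k_2}k_1^{k_1}k_2^{k_2}}{(k_1+k_2)^{k_1+k_2}}\right)^t c_{tk_1,tk_2}=\frac{1}{\sqrt{2\pi}}\sqrt{\frac{k_1+k_2}{k_1k_2}}\,\frac{1}{1-\frac{(k_1+k_2)^2}{r^2k_1k_2}};$$ (ii) if $\frac{(k_1+k_2)^2}{r^2k_1k_2}=1$, $$\lim_{t\to\infty}\frac{c_{tk_1,tk_2}}{\left(\frac r2-\sqrt{\frac{r^2}{4}-1}\right)^{t(k_1-k_2)}}=\frac{1}{2\sqrt{1-\frac4{r^2}}};$$ (iii) if $\frac{(k_1+k_2)^2}{r^2k_1k_2}>1$, $$\lim_{t\to\infty}\frac{c_{tk_1,tk_2}}{\left(\frac r2-\sqrt{\frac{r^2}{4}-1}\right)^{t(k_1-k_2)}}=\frac{1}{\sqrt{1-\frac4{r^2}}}.$$ In (i) the convergence is uniform on compact subsets of the region $\{r>2,\ \frac{(k_1+k_2)^2}{r^2k_1k_2}<1\}$, and in (iii) it is uniform on compact subsets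 of the region $\{r>2,\ \frac{(k_1+k_2)^2}{r^2k_1k_2}>1\}$.
   Context: $c_{k_1,k_2}$ are the Fourier coefficients of the spectral density function $1/|p|^2$ of the stable polynomial $p$ on the torus $\mathbb{T}^2$. *)

(* Defs.v *)
From Stdlib Require Import Reals.
From Coquelicot Require Import Coquelicot.
Open Scope R_scope.

Definition eit (theta : R) : C := (cos theta, sin theta).

Definition p (r : R) (z1 z2 : C) : C := (RtoC 1 - (z1 + z2) / RtoC r)%C.

Definition integrand (r : R) (k1 k2 : Z) (th1 th2 : R) : C :=
  (eit (- (IZR k1 * th1 + IZR k2 * th2)) *
   RtoC (/ (Cmod (p r (eit th1) (eit th2)) ^ 2)))%C.

Definition CInt (f : R -> C) (a b : R) : C :=
  @RInt C_R_CompleteNormedModule f a b.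

Definition c (r : R) (k1 k2 : Z) : C :=
  (RtoC (/ (4 * PI ^ 2)) *
   CInt (fun th1 => CInt (fun th2 => integrand r k1 k2 th1 th2) 0 (2 * PI)) 0 (2 * PI))%C.

Definition qq (r : R) (k1 k2 : nat) : R :=
  (INR k1 + INR k2) ^ 2 / (r ^ 2 * INR k1 * INR k2).

Definition ct (r : R) (k1 k2 t : nat) : C :=
  c r (Z.of_nat (t * k1)) (Z.of_nat (t * k2)).

Definition base1 (r : R) (k1 k2 : nat) : R :=
  r ^ (k1 + k2) * INR k1 ^ k1 * INR k2 ^ k2 / (INR k1 + INR k2) ^ (k1 + k2).

Definition seq1 (r : R) (k1 k2 t : nat) : C :=
  (RtoC (sqrt (INR t) * base1 r k1 k2 ^ t) * ct r k1 k2 t)%C.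

Definition lim1 (r : R) (k1 k2 : nat) : R :=
  / sqrt (2 * PI) * sqrt ((INR k1 + INR k2) / (INR k1 * INR k2))
  * / (1 - qq r k1 k2).

Definition rho (r : R) : R := r / 2 - sqrt (r ^ 2 / 4 - 1).

Definition seq23 (r : R) (k1 k2 t : nat) : C :=
  (ct r k1 k2 t / RtoC (rho r ^ (t * (k1 - k2))))%C.

Definition lim2 (r : R) : R := / (2 * sqrt (1 - 4 / r ^ 2)).
Definition lim3 (r : R) : R := / sqrt (1 - 4 / r ^ 2).

Definition unif_cvg_on (K : R -> Prop) (u : R -> nat -> C) (l : R -> C) : Prop :=
  forall eps : R, 0 < eps ->
  exists N : nat, forall t : nat, (N <= t)%nat ->
  forall r : R, K r -> Cmod (u r t - l r)%C < eps.

(* Main.v *)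
(** Write [w = (z1 + z2) / r].  Expanding [1 / |p|^2] as the product of the geometric series in [w]
    and in its conjugate, and using that the conjugate of [z1 + z2] is [(z1 + z2) / (z1 z2)] on the
    torus, one finds, for [a >= b] and [d = a - b], that the coefficient [c_{a,b}] is the tail
    [sum_{m >= b} g_m] of the series with terms [g_m = C(2m + d, m) / r^(2m + d)].

    The complete series satisfies a linear recurrence in [d] whose only bounded solution is
    [rho^d / sqrt (1 - 4 / r^2)].  The ratio [g_{m+1} / g_m] is essentially decreasing in [m] and equals
    about [qq] at [m = b].  If [qq < 1], the tail is asymptotically a geometric series with ratio [qq]
    starting at [g_b], which Stirling's formula evaluates.  If [qq > 1], the terms below [b] grow
    geometrically up to [g_b = O(rho^d / sqrt t)], so the tail exhausts the complete series.  If
    [qq = 1], the terms peak at [b] and are nearly symmetric around it within a window of size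
    [A sqrt t], outside of which at most a fraction [O(1 / A)] of the mass lies: the tail is half of
    the complete series. *)

Require Import Defs.
From Stdlib Require Import Reals Lra Lia ZArith.
From Coquelicot Require Import Coquelicot.
Open Scope R_scope.

(** * Fourier coefficients of 1/|p|^2 as a series of binomial coefficients *)

(** Uniformity in [r] shapes the estimates. The edge term is a power of [1 / r] times a binomial
    coefficient, and its asymptotics are put into [scaled_binomial], which does not involve [r].
    What remains depends on [r] only through a bound on [qq], and a compact set of parameters keeps
    [qq] away from 1. Comparing the edge term with [rho ^ d] uniformly in [r] amounts to Gibbs'
    inequality, whose constant 1 survives the [t]-th power.

    The exact ratio of consecutive terms is a decreasing function of the index times a factor 1 -
    1/(2x + d). Upper bounds drop this factor. Lower bounds on the growth before the edge need [d]
    large, which is available because [qq >= 1] forces [k1 > k2].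

    In (ii), with a window of about A sqrt t, the errors of the mirrored pairs accumulate to O(A^3 /
    sqrt t) for large A. Hence A is fixed in terms of [eps] before [t] grows. *)

Lemma eit_add (x y : R) : eit (x + y) = (eit x * eit y)%C.
Proof.
  unfold eit, Cmult; simpl; rewrite cos_plus, sin_plus; f_equal; ring.
Qed.

Lemma eit_0 : eit 0 = RtoC 1.
Proof. unfold eit; rewrite cos_0, sin_0; reflexivity. Qed.

Lemma Cmod_eit (x : R) : Cmod (eit x) = 1.
Proof.
  unfold Cmod, eit; cbn [fst snd].
  replace (cos x ^ 2 + sin x ^ 2) with 1; [apply sqrt_1|].
  pose proof (sin2_cos2 x) as H; unfold Rsqr in H; lra.
Qed.

Lemma Cconj_eit (x : R) : Cconj (eit x) = eit (- x).
Proof. unfold Cconj, eit; simpl; now rewrite cos_neg, sin_neg. Qed.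

(** * Integrals of complex-valued functions over the circle and the torus *)

Lemma is_RInt_pair (f : R -> C) (a b : R) (u v : R) :
  is_RInt (fun x => Re (f x)) a b u -> is_RInt (fun x => Im (f x)) a b v ->
  @is_RInt C_R_NormedModule f a b (u, v).
Proof.
  intros Hu Hv.
  apply (is_RInt_fct_extend_pair (U := R_NormedModule) (V := R_NormedModule)); assumption.
Qed.

Lemma sin_period_Z (k : Z) : sin (IZR k * (2 * PI)) = 0.
Proof.
  apply sin_eq_0_1; exists (2 * k)%Z; rewrite mult_IZR; ring.
Qed.

Lemma cos_period_Z (k : Z) : cos (IZR k * (2 * PI)) = 1.
Proof.
  replace (IZR k * (2 * PI)) with (2 * (IZR k * PI)) by ring.
  rewrite cos_2a_sin, (sin_eq_0_1 (IZR k * PI)); [ring|now exists k].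
Qed.

Lemma is_RInt_eit (k : Z) :
  @is_RInt C_R_NormedModule (fun x => eit (IZR k * x)) 0 (2 * PI)
    (RtoC (if Z.eq_dec k 0 then 2 * PI else 0)).
Proof.
  destruct (Z.eq_dec k 0) as [->|Hk].
  - apply (is_RInt_ext (V := C_R_NormedModule) (fun _ => RtoC 1)).
    + intros x _; rewrite Rmult_0_l, eit_0; reflexivity.
    + apply is_RInt_pair; simpl.
      * replace (2 * PI) with (scal (2 * PI - 0) 1 : R) at 2
          by (unfold scal; simpl; unfold mult; simpl; ring).
        apply (is_RInt_const (V := R_NormedModule)).
      * replace 0 with (scal (2 * PI - 0) 0 : R) at 2
          by (unfold scal; simpl; unfold mult; simpl; ring).
        apply (is_RInt_const (V := R_NormedModule)).
  - assert (Hk' : IZR k <> 0) by (now apply not_0_IZR).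
    apply is_RInt_pair; simpl.
    + evar_last.
      * apply (is_RInt_derive (fun x => sin (IZR k * x) / IZR k)).
        -- intros x _; auto_derive; [easy|now field].
        -- intros x _; apply (continuous_comp (fun y => IZR k * y) cos).
           ++ apply (continuous_scal_r (IZR k) (fun y : R => y)), continuous_id.
           ++ apply continuous_cos.
      * unfold minus, plus, opp; simpl.
        rewrite sin_period_Z, Rmult_0_r, sin_0; field; assumption.
    + evar_last.
      * apply (is_RInt_derive (fun x => - cos (IZR k * x) / IZR k)).
        -- intros x _; auto_derive; [easy|now field].
        -- intros x _; apply (continuous_comp (fun y => IZR k * y) sin).
           ++ apply (continuous_scal_r (IZR k) (fun y : R => y)), continuous_id.
           ++ apply continuous_sin.
      * unfold minus, plus, opp; simpl.
        rewrite cos_period_Z, Rmult_0_r, cos_0; field; assumption.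
Qed.

(** The module structure is over the reals, so a complex constant has to be pulled out coordinate by
    coordinate. *)
Lemma is_RInt_Cmult_l (z : C) (f : R -> C) (a b : R) (v : C) :
  @is_RInt C_R_NormedModule f a b v ->
  @is_RInt C_R_NormedModule (fun x => z * f x)%C a b (z * v)%C.
Proof.
  intros H.
  pose proof (is_RInt_fct_extend_fst (U := R_NormedModule) (V := R_NormedModule) _ _ _ _ H) as H1.
  pose proof (is_RInt_fct_extend_snd (U := R_NormedModule) (V := R_NormedModule) _ _ _ _ H) as H2.
  apply is_RInt_pair; simpl.
  - apply (is_RInt_minus (V := R_NormedModule)); now apply (is_RInt_scal (V := R_NormedModule)).
  - apply (is_RInt_plus (V := R_NormedModule)); now apply (is_RInt_scal (V := R_NormedModule)).
Qed.

(* Witnessed by the inner integrals, since Coquelicot's [RInt] of a non-integrable function is a junk value. *)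
Definition is_torus_integral (f : R -> R -> C) (v : C) : Prop :=
  exists g : R -> C,
    (forall x, @is_RInt C_R_NormedModule (f x) 0 (2 * PI) (g x)) /\
    @is_RInt C_R_NormedModule g 0 (2 * PI) v.

Lemma is_torus_integral_ext (f g : R -> R -> C) (v : C) :
  (forall x y, f x y = g x y) -> is_torus_integral f v -> is_torus_integral g v.
Proof.
  intros E (h & H1 & H2); exists h; split; [intros x|exact H2].
  apply (is_RInt_ext (V := C_R_NormedModule) (f x)); auto.
Qed.

Lemma is_torus_integral_plus (f g : R -> R -> C) (u v : C) :
  is_torus_integral f u -> is_torus_integral g v ->
  is_torus_integral (fun x y => f x y + g x y)%C (u + v)%C.
Proof.
  intros (h & H1 & H2) (h' & H1' & H2'); exists (fun x => h x + h' x)%C; split.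
  - intros x; apply (is_RInt_plus (V := C_R_NormedModule)); auto.
  - apply (is_RInt_plus (V := C_R_NormedModule)); auto.
Qed.

Lemma is_torus_integral_scal (k : C) (f : R -> R -> C) (u : C) :
  is_torus_integral f u ->
  is_torus_integral (fun x y => k * f x y)%C (k * u)%C.
Proof.
  intros (h & H1 & H2); exists (fun x => k * h x)%C; split.
  - intros x; now apply is_RInt_Cmult_l.
  - now apply is_RInt_Cmult_l.
Qed.

Lemma is_torus_integral_char (a b : Z) :
  is_torus_integral (fun x y => eit (IZR a * x) * eit (IZR b * y))%C
    (RtoC (if Z.eq_dec a 0 then if Z.eq_dec b 0 then 4 * PI ^ 2 else 0 else 0)).
Proof.
  set (A := if Z.eq_dec a 0 then 2 * PI else 0).
  set (B := if Z.eq_dec b 0 then 2 * PI else 0).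
  replace (RtoC _) with (RtoC B * RtoC A)%C.
  2:{ rewrite <- RtoC_mult; f_equal; unfold A, B.
      destruct (Z.eq_dec a 0), (Z.eq_dec b 0); ring. }
  exists (fun x => RtoC B * eit (IZR a * x))%C; split.
  - intros x; rewrite Cmult_comm; apply is_RInt_Cmult_l, is_RInt_eit.
  - apply is_RInt_Cmult_l, is_RInt_eit.
Qed.

Lemma is_torus_integral_sum (F : nat -> R -> R -> C) (v : nat -> R) (n : nat) :
  (forall i, is_torus_integral (F i) (RtoC (v i))) ->
  is_torus_integral (fun x y => sum_n (fun i => F i x y) n) (RtoC (sum_n v n)).
Proof.
  intros H; induction n as [|n IH].
  - rewrite sum_O; apply (is_torus_integral_ext (F 0%nat)); [|apply H].
    intros; now rewrite sum_O.
  - rewrite sum_Sn; unfold plus at 1; simpl; rewrite RtoC_plus.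
    apply (is_torus_integral_ext (fun x y => sum_n (fun i => F i x y) n + F (S n) x y)%C).
    + intros; now rewrite sum_Sn.
    + now apply is_torus_integral_plus.
Qed.

(** The uniform structure here is that of a product, with squares as balls; the modulus dominates
    both coordinates. *)
Lemma ball_C_of_Cmod (x y : C) (eps : R) :
  Cmod (y - x)%C < eps -> @ball C_R_NormedModule x eps y.
Proof.
  intros H; pose proof (Rmax_Cmod (y - x)%C) as M; simpl in M.
  split; unfold ball; simpl; unfold AbsRing_ball, abs, minus, plus, opp; simpl.
  - eapply Rle_lt_trans; [apply Rmax_l|eapply Rle_lt_trans; [apply M|exact H]].
  - eapply Rle_lt_trans; [apply Rmax_r|eapply Rle_lt_trans; [apply M|exact H]].
Qed.

Lemma filterlim_unif_C (f : nat -> R -> C) (g : R -> C) (e : nat -> R) :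
  is_lim_seq e 0 -> (forall n x, Cmod (f n x - g x)%C <= e n) ->
  filterlim f eventually (@locally (fct_UniformSpace R C_R_NormedModule) g).
Proof.
  intros He H.
  apply filterlim_locally; intros eps.
  apply is_lim_seq_spec in He; destruct (He eps) as [N HN].
  exists N; intros n Hn x; apply ball_C_of_Cmod.
  eapply Rle_lt_trans; [apply H|].
  specialize (HN n Hn); rewrite Rminus_0_r in HN.
  eapply Rle_lt_trans; [apply Rle_abs|exact HN].
Qed.

Lemma RInt_unif_lim_C (f : nat -> R -> C) (g : R -> C) (h : nat -> C) (a b : R) (e : nat -> R) :
  is_lim_seq e 0 -> (forall n x, Cmod (f n x - g x)%C <= e n) ->
  (forall n, @is_RInt C_R_NormedModule (f n) a b (h n)) ->
  @is_RInt C_R_NormedModule g a b (CInt g a b) /\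
  filterlim h eventually (@locally C_R_NormedModule (CInt g a b)).
Proof.
  intros He H Hf.
  destruct (filterlim_RInt (V := C_R_CompleteNormedModule) f a b eventually eventually_filter
    g h Hf (filterlim_unif_C _ _ _ He H)) as (I & L & HI).
  unfold CInt; rewrite (is_RInt_unique (V := C_R_CompleteNormedModule) _ _ _ _ HI); auto.
Qed.

(** Uniform convergence at rate [e] gives uniform convergence of the inner integrals at rate
    [2 * PI * e], so the one-dimensional statement applies twice. Integrability of the limit, inner
    and outer, comes out along the way and gives the iterated [CInt] its meaning. *)
Lemma torus_integral_unif_lim (f : nat -> R -> R -> C) (g : R -> R -> C) (v : nat -> C) (e : nat -> R) :
  is_lim_seq e 0 -> (forall n x y, Cmod (f n x y - g x y)%C <= e n) ->
  (forall n, is_torus_integral (f n) (v n)) ->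
  filterlim v eventually
    (@locally C_R_NormedModule (CInt (fun x => CInt (g x) 0 (2 * PI)) 0 (2 * PI))).
Proof.
  intros He H Hf.
  pose proof PI_RGT_0 as HPI.
  set (h := fun n x => CInt (f n x) 0 (2 * PI)).
  assert (Hh : forall n x, @is_RInt C_R_NormedModule (f n x) 0 (2 * PI) (h n x)).
  { intros n x; destruct (Hf n) as (k & H1 & _).
    unfold h, CInt; apply (RInt_correct (V := C_R_CompleteNormedModule)); now exists (k x). }
  assert (Hv : forall n, @is_RInt C_R_NormedModule (h n) 0 (2 * PI) (v n)).
  { intros n; destruct (Hf n) as (k & H1 & H2).
    apply (is_RInt_ext (V := C_R_NormedModule) k); [|exact H2].
    intros x _; symmetry; apply (is_RInt_unique (V := C_R_CompleteNormedModule)), H1. }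
  apply (RInt_unif_lim_C h _ v 0 (2 * PI) (fun n => 2 * PI * e n)).
  - replace (Finite 0) with (Rbar_mult (2 * PI) 0) by (simpl; f_equal; ring).
    now apply is_lim_seq_scal_l.
  - intros n x.
    destruct (RInt_unif_lim_C (fun n => f n x) (g x) (fun n => h n x) 0 (2 * PI) e)
      as [Hg _]; auto.
    rewrite Cmod_norm.
    replace (2 * PI * e n) with ((2 * PI - 0) * e n) by ring.
    apply (norm_RInt_le_const (V := C_R_NormedModule) (fun y => f n x y - g x y)%C).
    + lra.
    + intros y _; rewrite <- Cmod_norm; apply H.
    + apply (is_RInt_minus (V := C_R_NormedModule)); [apply Hh|exact Hg].
  - exact Hv.
Qed.

(* Coefficient of [z1^a z2^b] in [(z1 + z2)^n]. *)
Fixpoint walk (n : nat) (a b : Z) : R :=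
  match n with
  | O => if Z.eq_dec a 0 then if Z.eq_dec b 0 then 1 else 0 else 0
  | S n => walk n (a - 1) b + walk n a (b - 1)
  end.

Lemma walk_off_diagonal (n : nat) (a b : Z) :
  (a + b <> Z.of_nat n)%Z -> walk n a b = 0.
Proof.
  revert a b; induction n as [|n IH]; intros a b H; simpl.
  - destruct (Z.eq_dec a 0), (Z.eq_dec b 0); auto; lia.
  - rewrite !IH by lia; ring.
Qed.

Lemma walk_neg (n : nat) (a b : Z) : (a < 0)%Z \/ (b < 0)%Z -> walk n a b = 0.
Proof.
  revert a b; induction n as [|n IH]; intros a b H; simpl.
  - destruct (Z.eq_dec a 0), (Z.eq_dec b 0); auto; lia.
  - rewrite !IH by lia; ring.
Qed.

Lemma walk_binomial (n i j : nat) :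
  (i + j = n)%nat -> walk n (Z.of_nat i) (Z.of_nat j) = Binomial.C n j.
Proof.
  revert i j; induction n as [|n IH]; intros i j H.
  - replace i with 0%nat by lia; replace j with 0%nat by lia; simpl.
    now rewrite C_n_0.
  - cbn [walk].
    destruct i as [|i], j as [|j].
    + lia.
    + rewrite (walk_neg n (Z.of_nat 0 - 1)) by lia.
      replace (Z.of_nat (S j) - 1)%Z with (Z.of_nat j) by lia.
      rewrite IH by lia; replace n with j by lia; rewrite !C_n_n; ring.
    + rewrite (walk_neg n _ (Z.of_nat 0 - 1)) by lia.
      replace (Z.of_nat (S i) - 1)%Z with (Z.of_nat i) by lia.
      rewrite IH by lia; rewrite !C_n_0; ring.
    + replace (Z.of_nat (S i) - 1)%Z with (Z.of_nat i) by lia.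
      replace (Z.of_nat (S j) - 1)%Z with (Z.of_nat j) by lia.
      rewrite !IH by lia; rewrite <- pascal by lia; ring.
Qed.

(** Multiplying by one more factor [eit x + eit y] lowers one of the two frequencies by 1, which is
    exactly the recursion of [walk]. Frequencies may become negative on the way, hence indices in
    Z. *)
Lemma is_torus_integral_pow (n : nat) (a b : Z) :
  is_torus_integral (fun x y => eit (- (IZR a * x + IZR b * y)) * (eit x + eit y) ^ n)%C
    (RtoC (4 * PI ^ 2 * walk n a b)).
Proof.
  revert a b; induction n as [|n IH]; intros a b.
  - eapply is_torus_integral_ext; cycle 1.
    + replace (4 * PI ^ 2 * walk 0 a b) with
        (if Z.eq_dec (- a) 0 then if Z.eq_dec (- b) 0 then 4 * PI ^ 2 else 0 else 0).
      * apply is_torus_integral_char.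
      * simpl; destruct (Z.eq_dec (- a) 0), (Z.eq_dec a 0), (Z.eq_dec b 0), (Z.eq_dec (- b) 0);
          try lia; ring.
    + intros x y; simpl; rewrite <- eit_add, Cmult_1_r; f_equal.
      rewrite !opp_IZR; ring.
  - apply (is_torus_integral_ext (fun x y =>
      eit (- (IZR (a - 1) * x + IZR b * y)) * (eit x + eit y) ^ n +
      eit (- (IZR a * x + IZR (b - 1) * y)) * (eit x + eit y) ^ n)%C).
    + intros x y; rewrite Cpow_S.
      replace (- (IZR (a - 1) * x + IZR b * y)) with (- (IZR a * x + IZR b * y) + x)
        by (rewrite minus_IZR; ring).
      replace (- (IZR a * x + IZR (b - 1) * y)) with (- (IZR a * x + IZR b * y) + y)
        by (rewrite minus_IZR; ring).
      rewrite !eit_add; ring.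
    + cbn [walk]; rewrite Rmult_plus_distr_l, RtoC_plus.
      now apply is_torus_integral_plus.
Qed.

Definition step (r x y : R) : C := ((eit x + eit y) / RtoC r)%C.

Lemma Cconj_sum_eit (x y : R) :
  Cconj (eit x + eit y)%C = (eit (- (x + y)) * (eit x + eit y))%C.
Proof.
  rewrite Cmult_plus_distr_l, <- !eit_add, Cplus_conj, !Cconj_eit, Cplus_comm.
  f_equal; f_equal; ring.
Qed.

Lemma eit_pow (x : R) (n : nat) : (eit x ^ n)%C = eit (INR n * x).
Proof.
  induction n as [|n IH].
  - simpl; now rewrite Rmult_0_l, eit_0.
  - rewrite Cpow_S, IH, <- eit_add, S_INR; f_equal; ring.
Qed.

Lemma Cconj_R (x : R) : Cconj (RtoC x) = RtoC x.
Proof. unfold Cconj, RtoC; simpl; f_equal; ring. Qed.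

Lemma Cpow_div (u : C) (r : R) (n : nat) : r <> 0 ->
  ((u / RtoC r) ^ n)%C = (RtoC (/ r ^ n) * u ^ n)%C.
Proof.
  intros Hr; unfold Cdiv.
  rewrite Cpow_mult_l, <- RtoC_inv, <- RtoC_pow, pow_inv by assumption; ring.
Qed.

Lemma step_term (r : R) (a b : Z) (j l : nat) (x y : R) : r <> 0 ->
  (eit (- (IZR a * x + IZR b * y)) * (step r x y ^ j * Cconj (step r x y) ^ l))%C =
  (RtoC (/ r ^ (j + l)) *
   (eit (- (IZR (a + Z.of_nat l) * x + IZR (b + Z.of_nat l) * y)) * (eit x + eit y) ^ (j + l)))%C.
Proof.
  intros Hr; unfold step.
  rewrite Cdiv_conj by (intros E; apply RtoC_inj in E; auto).
  rewrite Cconj_R, !Cpow_div by assumption.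
  rewrite Cconj_sum_eit, Cpow_mult_l, eit_pow, Cpow_add_r, pow_add, Rinv_mult, RtoC_mult.
  replace (- (IZR (a + Z.of_nat l) * x + IZR (b + Z.of_nat l) * y))
    with (- (IZR a * x + IZR b * y) + INR l * (- (x + y)))
    by (rewrite !plus_IZR, <- !INR_IZR_INZ; ring).
  rewrite eit_add; ring.
Qed.

Lemma sum_n_single (u : nat -> R) (k n : nat) :
  (k <= n)%nat -> (forall i, i <> k -> u i = 0) -> sum_n u n = u k.
Proof.
  intros Hk H.
  assert (Z0 : forall m, (m < k)%nat -> sum_n u m = 0).
  { induction m as [|m IH]; intros Hm.
    - rewrite sum_O; apply H; lia.
    - rewrite sum_Sn, IH, H by lia; unfold plus; simpl; ring. }
  induction n as [|n IH].
  - replace k with 0%nat by lia; apply sum_O.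
  - rewrite sum_Sn; unfold plus; simpl.
    destruct (Nat.eq_dec k (S n)) as [->|Hn].
    + rewrite Z0 by lia; ring.
    + rewrite IH, (H (S n)) by lia; ring.
Qed.

(* The Green function at distance [d] of the walk on Z jumping to each neighbour with weight [1 / r] is
   the sum of these terms. *)
Definition green (d : nat) (r : R) (m : nat) : R :=
  Binomial.C (2 * m + d) m / r ^ (2 * m + d).

(** For a given [l] only total degree a + b + 2l survives integration, that is [j = l + a + b]. The
    inner sum runs to [m + (a + b)] so that it contains this index for every [l <= m]. *)
Lemma is_torus_integral_trunc (r : R) (a b m : nat) : r <> 0 -> (b <= a)%nat ->
  is_torus_integral
    (fun x y => sum_n (fun l => sum_n (fun j =>
       eit (- (IZR (Z.of_nat a) * x + IZR (Z.of_nat b) * y)) *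
         (step r x y ^ j * Cconj (step r x y) ^ l))%C (m + (a + b))) m)
    (RtoC (4 * PI ^ 2 * sum_n (fun l => green (a - b) r (b + l)) m)).
Proof.
  intros Hr Hab.
  set (v := fun l => sum_n (fun j => / r ^ (j + l) *
     (4 * PI ^ 2 * walk (j + l) (Z.of_nat a + Z.of_nat l) (Z.of_nat b + Z.of_nat l))) (m + (a + b))).
  replace (4 * PI ^ 2 * _) with (sum_n v m).
  - apply is_torus_integral_sum; intros l; apply is_torus_integral_sum; intros j.
    apply (is_torus_integral_ext (fun x y => RtoC (/ r ^ (j + l)) *
   (eit (- (IZR (Z.of_nat a + Z.of_nat l) * x + IZR (Z.of_nat b + Z.of_nat l) * y)) * (eit x + eit y) ^ (j + l)))%C).
    + intros x y; now rewrite step_term.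
    + rewrite RtoC_mult; apply is_torus_integral_scal, is_torus_integral_pow.
  - change (4 * PI ^ 2 * sum_n (fun l => green (a - b) r (b + l)) m)
      with (mult (4 * PI ^ 2) (sum_n (fun l => green (a - b) r (b + l)) m)).
    rewrite <- (sum_n_mult_l (K := R_Ring)).
    unfold sum_n; apply sum_n_m_ext_loc; intros l Hl; change mult with Rmult.
    match goal with |- @eq _ ?x ?y => change (@eq R x y) end.
    unfold v; rewrite (sum_n_single _ (l + a + b)); [| lia |].
    + rewrite <- !Nat2Z.inj_add, walk_binomial by lia.
      unfold green.
      replace (2 * (b + l) + (a - b))%nat with (l + a + b + l)%nat by lia.
      unfold Rdiv; ring.
    + intros j Hj; rewrite walk_off_diagonal by lia; ring.
Qed.

(** * Truncation error of the double geometric series *)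

Lemma geometric_sum_C (w : C) (n : nat) :
  ((1 - w) * sum_n (fun j => w ^ j) n = 1 - w ^ S n)%C.
Proof.
  induction n as [|n IH].
  - rewrite sum_O; simpl; ring.
  - rewrite sum_Sn; unfold plus; simpl; rewrite Cmult_plus_distr_l, IH; simpl; ring.
Qed.

Lemma Cmod_step (r x y : R) : 2 < r -> Cmod (step r x y) <= 2 / r.
Proof.
  intros Hr; unfold step.
  rewrite Cmod_div by (intros E; apply RtoC_inj in E; lra).
  rewrite Cmod_R, Rabs_pos_eq by lra.
  apply Rmult_le_compat_r; [left; apply Rinv_0_lt_compat; lra|].
  eapply Rle_trans; [apply Cmod_triangle|]; rewrite !Cmod_eit; lra.
Qed.

(** The truncated double sum is (1 - w^(n+1)) (1 - conj(w)^(m+1)) / |1 - w|^2. Expanding the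
    numerator leaves three error terms, each at most s^(m+1) because [m <= n]; the denominator is
    controlled by |1 - w| >= 1 - s. *)
Lemma trunc_error (w u : C) (s : R) (m n : nat) :
  0 <= s < 1 -> Cmod u = 1 -> Cmod w <= s -> (m <= n)%nat ->
  Cmod (sum_n (fun l => sum_n (fun j => u * (w ^ j * Cconj w ^ l))%C n) m -
        u * RtoC (/ (Cmod (1 - w) ^ 2)))%C <= 3 / (1 - s) ^ 2 * s ^ S m.
Proof.
  intros Hs Hu Hw Hmn.
  assert (Hp : 1 - s <= Cmod (1 - w)%C).
  { pose proof (Cmod_triangle (1 - w) w) as T.
    replace (1 - w + w)%C with (RtoC 1) in T by ring; rewrite Cmod_1 in T; lra. }
  assert (Hp2 : (1 - s) ^ 2 <= Cmod (1 - w)%C ^ 2) by (apply pow_incr; lra).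
  assert (Hs2 : 0 < (1 - s) ^ 2) by (apply pow_lt; lra).
  set (Q := RtoC (/ (Cmod (1 - w) ^ 2))).
  assert (HQ : (Q * ((1 - w) * Cconj (1 - w)) = 1)%C).
  { unfold Q; rewrite <- Cmod2_conj, <- RtoC_mult; f_equal; field; lra. }
  assert (E : sum_n (fun l => sum_n (fun j => u * (w ^ j * Cconj w ^ l))%C n) m =
    (u * (sum_n (fun j => w ^ j) n * sum_n (fun l => Cconj w ^ l) m))%C).
  { change (u * (sum_n (fun j => w ^ j) n * sum_n (fun l => Cconj w ^ l) m))%C
      with (mult u (mult (sum_n (fun j => w ^ j)%C n) (sum_n (fun l => Cconj w ^ l)%C m))).
    rewrite mult_assoc, <- (sum_n_mult_l (K := C_Ring)).
    apply sum_n_ext; intros l.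
    rewrite <- (sum_n_mult_l (K := C_Ring)), <- (sum_n_mult_r (K := C_Ring)).
    apply sum_n_ext; intros j.
    unfold mult; simpl; ring. }
  rewrite E.
  pose proof (geometric_sum_C w n) as G1.
  pose proof (geometric_sum_C (Cconj w) m) as G2.
  set (A := sum_n (fun j => w ^ j)%C n) in *.
  set (B := sum_n (fun l => Cconj w ^ l)%C m) in *.
  replace (Cconj (1 - w)) with (1 - Cconj w)%C in HQ
    by (rewrite Cminus_conj, Cconj_R; reflexivity).
  assert (HAB : (A * B = Q * ((1 - w ^ S n) * (1 - Cconj w ^ S m)))%C).
  { rewrite <- G1, <- G2.
    transitivity ((Q * ((1 - w) * (1 - Cconj w))) * (A * B))%C; [rewrite HQ|]; ring. }
  rewrite HAB.
  replace (u * (Q * ((1 - w ^ S n) * (1 - Cconj w ^ S m))) - u * Q)%C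
    with (u * (Q * (- w ^ S n + (- Cconj w ^ S m + w ^ S n * Cconj w ^ S m))))%C by ring.
  rewrite !Cmod_mult, Hu, Rmult_1_l.
  unfold Q at 1; rewrite Cmod_R, Rabs_pos_eq
    by (left; apply Rinv_0_lt_compat; lra).
  assert (Hn : Cmod (w ^ S n) <= s ^ S m).
  { rewrite Cmod_pow; apply Rle_trans with (s ^ S n).
    - apply pow_incr; split; [apply Cmod_ge_0|auto].
    - replace (S n) with (S m + (n - m))%nat by lia; rewrite pow_add.
      rewrite <- (Rmult_1_r (s ^ S m)) at 2; apply Rmult_le_compat_l; [apply pow_le; lra|].
      rewrite <- (pow1 (n - m)); apply pow_incr; lra. }
  assert (Hm : Cmod (Cconj w ^ S m) <= s ^ S m).
  { rewrite Cmod_pow, Cmod_conj; apply pow_incr; split; [apply Cmod_ge_0|auto]. }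
  assert (H1 : s ^ S m <= 1) by (rewrite <- (pow1 (S m)); apply pow_incr; lra).
  assert (H3 : Cmod (- w ^ S n + (- Cconj w ^ S m + w ^ S n * Cconj w ^ S m))%C <= 3 * s ^ S m).
  { eapply Rle_trans; [apply Cmod_triangle|].
    pose proof (Cmod_triangle (- Cconj w ^ S m)%C (w ^ S n * Cconj w ^ S m)%C) as T.
    rewrite Cmod_mult in T; rewrite !Cmod_opp in *.
    pose proof (Cmod_ge_0 (w ^ S n)%C); pose proof (Cmod_ge_0 (Cconj w ^ S m)%C).
    nra. }
  unfold Rdiv; rewrite (Rmult_comm 3), Rmult_assoc.
  apply Rmult_le_compat; try assumption.
  - left; apply Rinv_0_lt_compat; lra.
  - apply Cmod_ge_0.
  - apply Rinv_le_contravar; lra.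
Qed.

Lemma c_green (r : R) (a b : nat) : 2 < r -> (b <= a)%nat ->
  exists S : R, is_series (fun l => green (a - b) r (b + l)) S /\
    c r (Z.of_nat a) (Z.of_nat b) = RtoC S.
Proof.
  intros Hr Hab.
  assert (Hs : 0 <= 2 / r < 1).
  { split; [left; apply Rdiv_lt_0_compat; lra|].
    apply Rmult_lt_reg_r with r; [lra|]; field_simplify; lra. }
  assert (He : is_lim_seq (fun m => 3 / (1 - 2 / r) ^ 2 * (2 / r) ^ S m) 0).
  { replace (Finite 0) with (Rbar_mult (3 / (1 - 2 / r) ^ 2) 0) by (simpl; f_equal; ring).
    apply is_lim_seq_scal_l, (is_lim_seq_incr_1 (fun m => (2 / r) ^ m)).
    apply is_lim_seq_geom; rewrite Rabs_pos_eq; lra. }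
  epose proof (torus_integral_unif_lim _
    (fun x y => integrand r (Z.of_nat a) (Z.of_nat b) x y) _ _ He _
    (fun m => is_torus_integral_trunc r a b m ltac:(lra) Hab)) as L.
  Unshelve.
  2:{ intros m x y; unfold integrand, p.
      apply trunc_error; auto; [apply Cmod_eit|now apply Cmod_step|lia]. }
  unfold c.
  set (I := CInt _ 0 (2 * PI)) in *.
  set (u := fun m => 4 * PI ^ 2 * sum_n (fun l => green (a - b) r (b + l)) m) in *.
  assert (HPI : 0 < 4 * PI ^ 2) by (pose proof PI_RGT_0; nra).
  assert (L1 : is_lim_seq u (fst I)).
  { apply filterlim_locally; intros eps.
    apply (proj1 (filterlim_locally _ _)) with (eps := eps) in L.
    destruct L as [N HN]; exists N; intros n Hn; apply (HN n Hn). }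
  (* All truncated integrals are real, so the imaginary part of the limit is a limit of zeros. *)
  assert (L2 : is_lim_seq (fun _ => 0) (snd I)).
  { apply filterlim_locally; intros eps.
    apply (proj1 (filterlim_locally _ _)) with (eps := eps) in L.
    destruct L as [N HN]; exists N; intros n Hn; apply (HN n Hn). }
  exists (/ (4 * PI ^ 2) * fst I); split.
  - change (is_lim_seq (sum_n (fun l => green (a - b) r (b + l))) (/ (4 * PI ^ 2) * fst I)).
    apply (is_lim_seq_ext (fun m => / (4 * PI ^ 2) * u m)).
    + intros m; unfold u; field; apply PI_neq0.
    + apply (is_lim_seq_scal_l _ _ (Finite (fst I)) L1).
  - assert (E0 : snd I = 0).
    { apply is_lim_seq_unique in L2; rewrite Lim_seq_const in L2; now injection L2. }
    rewrite RtoC_mult; f_equal.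
    destruct I as [I1 I2]; simpl in *; subst; reflexivity.
Qed.

(** * The complete series *)

Lemma binomial_pos (n k : nat) : 0 < Binomial.C n k.
Proof.
  unfold Binomial.C; apply Rdiv_lt_0_compat; [apply INR_fact_lt_0|].
  apply Rmult_lt_0_compat; apply INR_fact_lt_0.
Qed.

Lemma binomial_le_pow2 (n k : nat) : (k <= n)%nat -> Binomial.C n k <= 2 ^ n.
Proof.
  revert k; induction n as [|n IH]; intros k Hk.
  - replace k with 0%nat by lia; rewrite C_n_0; simpl; lra.
  - assert (H1 : 1 <= 2 ^ n) by (apply pow_R1_Rle; lra).
    simpl pow; destruct k as [|k]; [rewrite C_n_0; lra|].
    destruct (Nat.eq_dec k n) as [->|Hn]; [rewrite C_n_n; lra|].
    rewrite <- pascal by lia.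
    pose proof (IH k ltac:(lia)); pose proof (IH (S k) ltac:(lia)); lra.
Qed.

Lemma green_pos (d : nat) (r : R) (m : nat) : 0 < r -> 0 < green d r m.
Proof.
  intros Hr; apply Rdiv_lt_0_compat; [apply binomial_pos|now apply pow_lt].
Qed.

(** The bound is independent of [d]. Besides convergence, it yields boundedness in [d] of the
    complete series, which selects the right solution of the recurrence. *)
Lemma green_le_geom (d : nat) (r : R) (m : nat) : 2 < r ->
  green d r m <= ((2 / r) ^ 2) ^ m.
Proof.
  intros Hr; unfold green.
  assert (H0 : 0 < 2 / r) by (apply Rdiv_lt_0_compat; lra).
  assert (H1 : 2 / r <= 1) by (apply Rmult_le_reg_r with r; [lra|]; field_simplify; lra).
  apply Rle_trans with ((2 / r) ^ (2 * m + d)).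
  - unfold Rdiv; rewrite Rpow_mult_distr, pow_inv.
    apply Rmult_le_compat_r; [left; apply Rinv_0_lt_compat, pow_lt; lra|].
    apply binomial_le_pow2; lia.
  - rewrite <- pow_mult, pow_add.
    rewrite <- (Rmult_1_r ((2 / r) ^ (2 * m))) at 2.
    apply Rmult_le_compat_l; [apply pow_le; lra|].
    rewrite <- (pow1 d); apply pow_incr; lra.
Qed.

Lemma sq_ratio_lt_1 (r : R) : 2 < r -> 0 <= (2 / r) ^ 2 < 1.
Proof.
  intros Hr.
  assert (H0 : 0 < 2 / r) by (apply Rdiv_lt_0_compat; lra).
  assert (H1 : 2 / r < 1) by (apply Rmult_lt_reg_r with r; [lra|]; field_simplify; lra).
  nra.
Qed.

Lemma ex_series_green (d : nat) (r : R) : 2 < r -> ex_series (green d r).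
Proof.
  intros Hr; pose proof (sq_ratio_lt_1 r Hr).
  apply (ex_series_le (V := R_CompleteNormedModule) _ (fun m => ((2 / r) ^ 2) ^ m)).
  - intros m; unfold norm; simpl; unfold abs; simpl.
    rewrite Rabs_pos_eq by (left; apply green_pos; lra).
    now apply green_le_geom.
  - apply ex_series_geom; rewrite Rabs_pos_eq; lra.
Qed.

Lemma green_0_0 (r : R) : green 0 r 0 = 1.
Proof. unfold green; simpl; rewrite C_n_0; field. Qed.

Lemma green_S_0 (d : nat) (r : R) : r <> 0 -> green (S d) r 0 = green d r 0 / r.
Proof.
  intros Hr; unfold green; simpl; rewrite !C_n_0; field; split; auto using pow_nonzero.
Qed.

Lemma green_S_S (d : nat) (r : R) (m : nat) : r <> 0 ->
  green (S d) r (S m) = (green d r (S m) + green (S (S d)) r m) / r.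
Proof.
  intros Hr; unfold green.
  replace (2 * S m + S d)%nat with (S (2 * m + S (S d))) by lia.
  replace (2 * S m + d)%nat with (2 * m + S (S d))%nat by lia.
  rewrite <- pascal by lia; simpl pow; field; split; auto using pow_nonzero.
Qed.

(** Pascal's rule at the centre of an even row gives two neighbours, equal by the symmetry of the
    odd row above. *)
Lemma green_0_S (r : R) (m : nat) : r <> 0 -> green 0 r (S m) = 2 * green 1 r m / r.
Proof.
  intros Hr; unfold green.
  replace (2 * S m + 0)%nat with (S (2 * m + 1)) by lia.
  rewrite <- pascal by lia.
  rewrite (pascal_step1 (2 * m + 1) (S m)) by lia.
  replace (2 * m + 1 - S m)%nat with m by lia.
  simpl pow; field; split; auto using pow_nonzero.
Qed.

Lemma Series_green_step (d : nat) (r : R) : 2 < r ->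
  Series (green (S d) r) = (Series (green d r) + Series (green (S (S d)) r)) / r.
Proof.
  intros Hr.
  pose proof (ex_series_green d r Hr) as E0; pose proof (ex_series_green (S (S d)) r Hr) as E2.
  rewrite (Series_incr_1 (green (S d) r)) by now apply ex_series_green.
  rewrite (Series_incr_1 (green d r)) by assumption.
  rewrite (Series_ext _ (fun m => / r * (green d r (S m) + green (S (S d)) r m))).
  2:{ intros m; rewrite green_S_S by lra; unfold Rdiv; ring. }
  rewrite Series_scal_l, Series_plus; [| now apply (ex_series_incr_1 (green d r)) | assumption].
  rewrite green_S_0 by lra; field; lra.
Qed.

(** The equation at the source, where the walk starts with mass 1 and both neighbours are at
    distance 1. It fixes the amplitude that the recurrence leaves free. *)
Lemma Series_green_0 (r : R) : 2 < r ->
  Series (green 0 r) = 1 + 2 * Series (green 1 r) / r.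
Proof.
  intros Hr.
  rewrite (Series_incr_1 (green 0 r)) by now apply ex_series_green.
  rewrite (Series_ext _ (fun m => 2 / r * green 1 r m)).
  2:{ intros m; rewrite green_0_S by lra; unfold Rdiv; ring. }
  rewrite Series_scal_l, green_0_0; field; lra.
Qed.

Lemma rho_bounds (r : R) : 2 < r -> 0 < rho r < 1.
Proof.
  intros Hr; unfold rho.
  assert (H : 0 < r ^ 2 / 4 - 1) by nra.
  pose proof (sqrt_lt_R0 _ H); pose proof (pow2_sqrt _ (Rlt_le _ _ H)).
  split; nra.
Qed.

Lemma rho_eq (r : R) : 2 < r -> r * rho r = 1 + rho r ^ 2.
Proof.
  intros Hr; unfold rho.
  assert (H : 0 < r ^ 2 / 4 - 1) by nra.
  pose proof (pow2_sqrt _ (Rlt_le _ _ H)); nra.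
Qed.

Lemma lim3_rho (r : R) : 2 < r -> lim3 r = / (1 - 2 * rho r / r).
Proof.
  intros Hr; unfold lim3; f_equal.
  assert (H : 0 < r ^ 2 / 4 - 1) by nra.
  pose proof (sqrt_lt_R0 _ H); pose proof (pow2_sqrt _ (Rlt_le _ _ H)).
  apply sqrt_lem_1.
  - apply Rmult_le_reg_r with (r ^ 2); [nra|]; field_simplify; nra.
  - unfold rho; replace (1 - 2 * (r / 2 - sqrt (r ^ 2 / 4 - 1)) / r)
      with (2 / r * sqrt (r ^ 2 / 4 - 1)) by (field; lra).
    apply Rmult_le_pos; [left; apply Rdiv_lt_0_compat|]; lra.
  - unfold rho; replace ((1 - 2 * (r / 2 - sqrt (r ^ 2 / 4 - 1)) / r) *
      (1 - 2 * (r / 2 - sqrt (r ^ 2 / 4 - 1)) / r))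
      with (4 / r ^ 2 * sqrt (r ^ 2 / 4 - 1) ^ 2) by (field; lra).
    rewrite pow2_sqrt by lra; field; lra.
Qed.

(* Of the two solutions rho^d and rho^(-d) of the recurrence only the first is bounded. *)
Lemma Series_green_geom (d : nat) (r : R) : 2 < r ->
  Series (green (S d) r) = rho r * Series (green d r).
Proof.
  intros Hr.
  pose proof (rho_bounds r Hr) as Hb; pose proof (rho_eq r Hr) as He.
  pose proof (sq_ratio_lt_1 r Hr) as Hq.
  set (G := fun d => Series (green d r)).
  (* Since [r] is the sum of [rho r] and its inverse, the recurrence factors; [h] is the defect from
     the [rho] solution, and it is multiplied by [/ rho r] at each step. Being bounded, it must
     vanish. *)
  set (h := fun k => G (S k) - rho r * G k).
  set (M := Series (fun m => ((2 / r) ^ 2) ^ m)).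
  assert (HG : forall k, 0 <= G k <= M).
  { intros k; split.
    - unfold G; rewrite <- (Rmult_0_l (Series (green k r))), <- Series_scal_l.
      apply Series_le; [|now apply ex_series_green].
      intros m; pose proof (green_pos k r m ltac:(lra)); lra.
    - apply Series_le.
      + intros m; split; [left; apply green_pos; lra|now apply green_le_geom].
      + apply ex_series_geom; rewrite Rabs_pos_eq; lra. }
  assert (Hh : forall k, h k = rho r * h (S k)).
  { intros k; unfold h, G.
    pose proof (Series_green_step k r Hr) as E.
    assert (E' : Series (green (S (S k)) r) = r * Series (green (S k) r) - Series (green k r))
      by (rewrite E; field; lra).
    rewrite E'.
    replace (rho r * (r * Series (green (S k) r) - Series (green k r) - rho r * Series (green (S k) r)))
      with ((r * rho r) * Series (green (S k) r) - rho r * Series (green k r)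
            - rho r ^ 2 * Series (green (S k) r)) by ring.
    rewrite He; ring. }
  assert (Hn : forall n k, h k = rho r ^ n * h (n + k)%nat).
  { induction n as [|n IH]; intros k; [simpl; ring|].
    rewrite Hh, (IH (S k)).
    replace (n + S k)%nat with (S n + k)%nat by lia; simpl; ring. }
  assert (Hbd : forall k, Rabs (h k) <= M).
  { intros k; unfold h; pose proof (HG k); pose proof (HG (S k)).
    apply Rabs_le; nra. }
  assert (Z : h d = 0).
  { apply Rabs_eq_0, Rle_antisym; [|apply Rabs_pos].
    assert (L : is_lim_seq (fun n => rho r ^ n * M) 0).
    { replace (Finite 0) with (Rbar_mult 0 M) by (simpl; f_equal; ring).
      apply (is_lim_seq_scal_r _ M 0), is_lim_seq_geom; rewrite Rabs_pos_eq; lra. }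
    apply (is_lim_seq_le (fun _ => Rabs (h d)) (fun n => rho r ^ n * M) (Rabs (h d)) 0);
      [|apply is_lim_seq_const|exact L].
    intros n; rewrite (Hn n d), Rabs_mult, (Rabs_pos_eq (rho r ^ n)) by (apply pow_le; lra).
    apply Rmult_le_compat_l; [apply pow_le; lra|apply Hbd]. }
  unfold h, G in Z; lra.
Qed.

Lemma Series_green (d : nat) (r : R) : 2 < r ->
  Series (green d r) = rho r ^ d * lim3 r.
Proof.
  intros Hr.
  pose proof (rho_bounds r Hr) as Hb.
  induction d as [|d IH].
  - pose proof (Series_green_0 r Hr) as E.
    rewrite Series_green_geom in E by assumption.
    rewrite lim3_rho by assumption.
    assert (0 < 1 - 2 * rho r / r).
    { apply Rmult_lt_reg_r with r; [lra|]; field_simplify; lra. }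
    apply Rmult_eq_reg_r with (1 - 2 * rho r / r); [|lra].
    simpl pow; rewrite Rmult_1_l, Rinv_l by lra; lra.
  - rewrite Series_green_geom, IH by assumption; simpl; ring.
Qed.

(** * Wallis and Stirling *)

Definition wallis (n : nat) : R := RInt (fun x => sin x ^ n) 0 (PI / 2).

Lemma continuous_sin_pow (n : nat) (x : R) : continuous (fun x => sin x ^ n) x.
Proof.
  apply (ex_derive_continuous (fun x => sin x ^ n)); auto_derive; auto.
Qed.

Lemma ex_RInt_sin_pow (n : nat) (a b : R) : ex_RInt (fun x => sin x ^ n) a b.
Proof.
  apply (ex_RInt_continuous (V := R_CompleteNormedModule)).
  intros; apply continuous_sin_pow.
Qed.

Lemma wallis_0 : wallis 0 = PI / 2.
Proof.
  unfold wallis; simpl; rewrite RInt_const; unfold scal; simpl; unfold mult; simpl; ring.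
Qed.

Lemma wallis_1 : wallis 1 = 1.
Proof.
  apply is_RInt_unique.
  evar_last.
  - apply (is_RInt_derive (fun x => - cos x)).
    + intros x _; auto_derive; [easy|ring].
    + intros x _; apply continuous_sin_pow.
  - unfold minus, plus, opp; simpl; rewrite cos_PI2, cos_0; ring.
Qed.

(** The combination (n+2) sin^(n+2) - (n+1) sin^n is the derivative of -cos sin^(n+1), which
    vanishes at both ends of the interval. *)
Lemma wallis_rec (n : nat) : INR (n + 2) * wallis (n + 2) = INR (n + 1) * wallis n.
Proof.
  assert (H : is_RInt (fun x => INR (n + 2) * sin x ^ (n + 2) - INR (n + 1) * sin x ^ n) 0 (PI / 2)
    (INR (n + 2) * wallis (n + 2) - INR (n + 1) * wallis n)).
  { apply (is_RInt_minus (V := R_NormedModule));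
      apply (is_RInt_scal (V := R_NormedModule)),
        (RInt_correct (V := R_CompleteNormedModule)), ex_RInt_sin_pow. }
  assert (H' : is_RInt (fun x => INR (n + 2) * sin x ^ (n + 2) - INR (n + 1) * sin x ^ n) 0 (PI / 2) 0).
  { evar_last.
    - apply (is_RInt_derive (fun x => - cos x * sin x ^ (n + 1))).
      + intros x _; auto_derive; [easy|].
        replace (Init.Nat.pred (n + 1)) with n by lia.
        replace (n + 2)%nat with (S (S n)) by lia.
        replace (n + 1)%nat with (S n) by lia.
        rewrite !S_INR.
        pose proof (sin2_cos2 x) as E; unfold Rsqr in E.
        transitivity (sin x * sin x ^ S n - (INR n + 1) * (cos x * cos x) * sin x ^ n); [ring|].
        replace (cos x * cos x) with (1 - sin x * sin x) by lra.
        simpl; ring.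
      + intros x _; apply (ex_derive_continuous (V := R_NormedModule)); auto_derive; auto.
    - unfold minus, plus, opp; simpl.
      rewrite cos_PI2, sin_0, pow_i by lia; ring. }
  apply (is_RInt_unique (V := R_CompleteNormedModule)) in H.
  apply (is_RInt_unique (V := R_CompleteNormedModule)) in H'.
  rewrite H in H'; lra.
Qed.

Lemma wallis_pos (n : nat) : 0 < wallis n.
Proof.
  enough (0 < wallis n /\ 0 < wallis (S n)) by tauto.
  induction n as [|n [H1 H2]].
  - rewrite wallis_0, wallis_1; pose proof PI_RGT_0; lra.
  - split; [assumption|].
    pose proof (wallis_rec n) as E; replace (n + 2)%nat with (S (S n)) in E by lia.
    apply Rmult_lt_reg_l with (INR (S (S n))); [apply lt_0_INR; lia|].
    rewrite Rmult_0_r, E; apply Rmult_lt_0_compat; [apply lt_0_INR; lia|assumption].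
Qed.

Lemma wallis_decr (n : nat) : wallis (S n) <= wallis n.
Proof.
  pose proof PI_RGT_0.
  apply RInt_le; try apply ex_RInt_sin_pow; [lra|].
  intros x Hx; simpl.
  assert (0 <= sin x) by (apply sin_ge_0; lra).
  pose proof (SIN_bound x); pose proof (pow_le (sin x) n ltac:(assumption)).
  nra.
Qed.

Lemma wallis_prod (n : nat) : INR (n + 1) * (wallis n * wallis (n + 1)) = PI / 2.
Proof.
  induction n as [|n IH].
  - simpl; rewrite wallis_0, wallis_1; ring.
  - replace (S n + 1)%nat with (n + 2)%nat by lia.
    replace (S n) with (n + 1)%nat by lia.
    rewrite <- IH; pose proof (wallis_rec n) as E.
    transitivity (wallis (n + 1) * (INR (n + 2) * wallis (n + 2))); [ring|rewrite E; ring].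
Qed.

Lemma central_binomial_step (n : nat) :
  INR (n + 1) * Binomial.C (2 * (n + 1)) (n + 1) = 2 * INR (2 * n + 1) * Binomial.C (2 * n) n.
Proof.
  unfold Binomial.C.
  replace (2 * (n + 1) - (n + 1))%nat with (S n) by lia.
  replace (2 * n - n)%nat with n by lia.
  replace (n + 1)%nat with (S n) by lia.
  replace (2 * S n)%nat with (S (S (2 * n))) by lia.
  replace (2 * n + 1)%nat with (S (2 * n)) by lia.
  rewrite !fact_simpl, !mult_INR, !S_INR, mult_INR; simpl (INR 2).
  pose proof (INR_fact_neq_0 n); pose proof (pos_INR n); field; lra.
Qed.

Lemma wallis_binomial (n : nat) : wallis (2 * n) = PI / 2 * Binomial.C (2 * n) n / 4 ^ n.
Proof.
  induction n as [|n IH].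
  - simpl; rewrite wallis_0; unfold Binomial.C; simpl; field.
  - replace (S n) with (n + 1)%nat by lia.
    pose proof (wallis_rec (2 * n)) as E.
    pose proof (central_binomial_step n) as B.
    replace (2 * (n + 1))%nat with (2 * n + 2)%nat in * by lia.
    assert (Hn : 0 < INR (n + 1)) by (apply lt_0_INR; lia).
    assert (E2 : INR (2 * n + 2) = 2 * INR (n + 1))
      by (replace (2 * n + 2)%nat with (2 * (n + 1))%nat by lia; rewrite mult_INR; reflexivity).
    rewrite E2, IH in E.
    apply Rmult_eq_reg_l with (2 * INR (n + 1)); [|lra].
    rewrite E.
    pose proof (pow_lt 4 n ltac:(lra)).
    transitivity (PI / (4 ^ (n + 1)) * (INR (n + 1) * Binomial.C (2 * n + 2) (n + 1))).
    + rewrite B, pow_add, pow_1.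
      field; repeat split; try apply pow_nonzero; lra.
    + field; apply pow_nonzero; lra.
Qed.

(** Write W for [wallis]. By monotonicity W(2n)^2 lies between W(2n) W(2n+1) and W(2n-1) W(2n), and
    both products are known exactly from [wallis_prod]. *)
Lemma wallis_limit : is_lim_seq (fun n => INR n * wallis (2 * n) ^ 2) (PI / 4).
Proof.
  pose proof PI_RGT_0 as HPI.
  apply (is_lim_seq_le_le_loc (fun n => PI / 4 - PI / 8 * / INR n) _ (fun _ => PI / 4)).
  - exists 1%nat; intros n Hn.
    assert (Hn0 : 1 <= INR n) by (apply (le_INR 1); lia).
    pose proof (wallis_prod (2 * n)) as P1.
    pose proof (wallis_prod (2 * n - 1)) as P2.
    replace (2 * n - 1 + 1)%nat with (2 * n)%nat in P2 by lia.
    pose proof (wallis_decr (2 * n)) as D1.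
    pose proof (wallis_decr (2 * n - 1)) as D2.
    replace (S (2 * n - 1)) with (2 * n)%nat in D2 by lia.
    replace (S (2 * n)) with (2 * n + 1)%nat in D1 by lia.
    pose proof (wallis_pos (2 * n)) as W.
    rewrite plus_INR, mult_INR in P1; rewrite mult_INR in P2.
    change (INR 2) with 2 in *; change (INR 1) with 1 in *.
    set (w := wallis (2 * n)) in *.
    assert (A : PI / 2 <= (2 * INR n + 1) * w ^ 2).
    { rewrite <- P1; replace ((2 * INR n + 1) * w ^ 2) with ((2 * INR n + 1) * (w * w)) by ring.
      apply Rmult_le_compat_l; [lra|]; apply Rmult_le_compat_l; lra. }
    assert (B : 2 * INR n * w ^ 2 <= PI / 2).
    { rewrite <- P2; replace (2 * INR n * w ^ 2) with (2 * INR n * (w * w)) by ring.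
      apply Rmult_le_compat_l; [lra|]; apply Rmult_le_compat_r; lra. }
    split; [|lra].
    assert (w ^ 2 <= PI / 4 * / INR n).
    { apply Rmult_le_reg_l with (2 * INR n); [lra|].
      replace (2 * INR n * (PI / 4 * / INR n)) with (PI / 2) by (field; lra); lra. }
    lra.
  - evar_last.
    + apply is_lim_seq_minus'; [apply is_lim_seq_const|].
      apply (is_lim_seq_scal_l _ (PI / 8) (Finite 0)).
      apply (is_lim_seq_inv _ p_infty); [apply is_lim_seq_INR|discriminate].
    + simpl; f_equal; ring.
  - apply is_lim_seq_const.
Qed.

(** * Stirling's formula from convexity bounds on the logarithm *)

Lemma nonneg_derivative_le (f df : R -> R) (y : R) : 0 <= y ->
  (forall x, 0 <= x <= y -> is_derive f x (df x)) ->
  (forall x, 0 <= x -> 0 <= df x) -> f 0 <= f y.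
Proof.
  intros Hy Hd Hp.
  destruct (MVT_gen f 0 y df) as (z & Hz & E).
  - intros x Hx; rewrite Rmin_left, Rmax_right in Hx by lra; apply Hd; lra.
  - intros x Hx; rewrite Rmin_left, Rmax_right in Hx by lra.
    apply continuity_pt_filterlim, (ex_derive_continuous f); exists (df x); apply Hd; lra.
  - rewrite Rmin_left, Rmax_right in Hz by lra.
    pose proof (Hp z ltac:(lra)); nra.
Qed.

(** The left side is the midpoint rule for the integral of 1/x over [1, 1 + y], an underestimate by
    convexity. *)
Lemma ln_1p_lower (y : R) : 0 <= y -> 2 * y / (2 + y) <= ln (1 + y).
Proof.
  intros Hy.
  pose proof (nonneg_derivative_le (fun y => ln (1 + y) - 2 * y / (2 + y))
    (fun y => y ^ 2 / ((1 + y) * (2 + y) ^ 2)) y Hy) as H; cbv beta in H.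
  rewrite Rplus_0_r, ln_1 in H.
  enough (0 - 2 * 0 / (2 + 0) <= ln (1 + y) - 2 * y / (2 + y)) by lra.
  apply H.
  - intros x Hx; auto_derive; [lra|]; field; lra.
  - intros x Hx; apply Rdiv_le_0_compat; [apply pow2_ge_0|]; nra.
Qed.

(** The right side is the trapezoidal rule for the same integral, an overestimate by convexity. *)
Lemma ln_1p_upper (y : R) : 0 <= y -> ln (1 + y) <= y * (2 + y) / (2 * (1 + y)).
Proof.
  intros Hy.
  pose proof (nonneg_derivative_le (fun y => y * (2 + y) / (2 * (1 + y)) - ln (1 + y))
    (fun y => y ^ 2 / (2 * (1 + y) ^ 2)) y Hy) as H; cbv beta in H.
  rewrite !Rplus_0_r, ln_1 in H.
  enough (0 * 2 / (2 * 1) - 0 <= y * (2 + y) / (2 * (1 + y)) - ln (1 + y)) by lra.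
  apply H.
  - intros x Hx; auto_derive; [lra|]; field; lra.
  - intros x Hx; apply Rdiv_le_0_compat; [apply pow2_ge_0|]; nra.
Qed.

Definition stirling (n : nat) : R :=
  INR (fact n) * exp (INR n) / (sqrt (INR n) * INR n ^ n).

Lemma stirling_pos (n : nat) : (0 < n)%nat -> 0 < stirling n.
Proof.
  intros Hn; pose proof (lt_0_INR n Hn); unfold stirling.
  apply Rdiv_lt_0_compat; apply Rmult_lt_0_compat;
    auto using INR_fact_lt_0, exp_pos, sqrt_lt_R0, pow_lt.
Qed.

Lemma ln_stirling (n : nat) : (0 < n)%nat ->
  ln (stirling n) = ln (INR (fact n)) + INR n - (INR n + / 2) * ln (INR n).
Proof.
  intros Hn; pose proof (lt_0_INR n Hn) as H; pose proof (INR_fact_lt_0 n) as Hf.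
  pose proof (exp_pos (INR n)); pose proof (sqrt_lt_R0 _ H); pose proof (pow_lt _ n H).
  unfold stirling; rewrite ln_div by (apply Rmult_lt_0_compat; assumption).
  rewrite !ln_mult, ln_exp, ln_pow by assumption.
  rewrite <- (sqrt_sqrt (INR n)) at 4 by lra.
  rewrite ln_mult by assumption.
  replace (ln (INR n)) with (2 * ln (sqrt (INR n))); [field|].
  rewrite <- (sqrt_sqrt (INR n)) at 2 by lra; rewrite ln_mult by assumption; ring.
Qed.

(** The difference equals (n + 1/2) ln(1 + 1/n) - 1. The midpoint bound makes it nonnegative; the
    trapezoidal bound gives exactly the telescoping right side, which keeps the logarithms bounded
    below and the limit positive. *)
Lemma ln_stirling_step (n : nat) : (0 < n)%nat ->
  0 <= ln (stirling n) - ln (stirling (S n)) <= / 4 * (/ INR n - / INR (S n)).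
Proof.
  intros Hn; pose proof (lt_0_INR n Hn) as H.
  rewrite !ln_stirling by lia.
  rewrite fact_simpl, mult_INR, ln_mult by (apply INR_fact_lt_0 || (apply lt_0_INR; lia)).
  rewrite S_INR.
  assert (E : ln (INR n + 1) = ln (INR n) + ln (1 + / INR n)).
  { pose proof (Rinv_0_lt_compat _ H); rewrite <- ln_mult by lra; f_equal; field; lra. }
  rewrite E.
  pose proof (Rinv_0_lt_compat _ H) as Hi.
  pose proof (ln_1p_lower (/ INR n) ltac:(lra)) as L.
  pose proof (ln_1p_upper (/ INR n) ltac:(lra)) as U.
  replace (2 * / INR n / (2 + / INR n)) with (/ (INR n + / 2)) in L by (field; lra).
  replace (/ INR n * (2 + / INR n) / (2 * (1 + / INR n)))
    with ((2 * INR n + 1) / (2 * INR n * (INR n + 1))) in U by (field; lra).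
  set (l := ln (1 + / INR n)) in *.
  apply (Rmult_le_compat_l (INR n + / 2)) in L; [|lra].
  apply (Rmult_le_compat_l (INR n + / 2)) in U; [|lra].
  rewrite Rinv_r in L by lra.
  split; [lra|].
  replace (/ 4 * (/ INR n - / (INR n + 1))) with
    ((INR n + / 2) * ((2 * INR n + 1) / (2 * INR n * (INR n + 1))) - 1) by (field; lra).
  lra.
Qed.

Lemma stirling_converges : exists L, 0 < L /\ is_lim_seq stirling L.
Proof.
  destruct (ex_finite_lim_seq_decr (fun n => ln (stirling (S n))) (ln (stirling 1) - / 4)) as [l Hl].
  - intros n; pose proof (ln_stirling_step (S n) ltac:(lia)); lra.
  - intros n.
    assert (H : ln (stirling 1) - / 4 <= ln (stirling (S n)) - / 4 * / INR (S n)).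
    { induction n as [|n IH]; [simpl; lra|].
      pose proof (ln_stirling_step (S n) ltac:(lia)); lra. }
    pose proof (Rinv_0_lt_compat (INR (S n)) ltac:(apply lt_0_INR; lia)); lra.
  - exists (exp l); split; [apply exp_pos|].
    apply is_lim_seq_incr_1.
    apply (is_lim_seq_ext (fun n => exp (ln (stirling (S n))))).
    + intros n; apply exp_ln, stirling_pos; lia.
    + apply (is_lim_seq_continuous exp); [|exact Hl].
      apply derivable_continuous_pt, derivable_pt_exp.
Qed.

Lemma fact_stirling (n : nat) : (0 < n)%nat ->
  INR (fact n) = stirling n * (sqrt (INR n) * INR n ^ n) / exp (INR n).
Proof.
  intros Hn; pose proof (lt_0_INR n Hn) as H; unfold stirling.
  pose proof (exp_pos (INR n)); pose proof (sqrt_lt_R0 _ H); pose proof (pow_lt _ n H).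
  field; lra.
Qed.

Lemma binomial_stirling (m n : nat) : (0 < m)%nat -> (0 < n)%nat ->
  Binomial.C (m + n) n = stirling (m + n) / (stirling m * stirling n) *
    (sqrt (INR m + INR n) / (sqrt (INR m) * sqrt (INR n))) *
    ((INR m + INR n) ^ (m + n) / (INR m ^ m * INR n ^ n)).
Proof.
  intros Hm Hn; unfold Binomial.C.
  replace (m + n - n)%nat with m by lia.
  rewrite !fact_stirling, plus_INR, exp_plus by lia.
  pose proof (lt_0_INR m Hm) as H1; pose proof (lt_0_INR n Hn) as H2.
  pose proof (exp_pos (INR n)); pose proof (sqrt_lt_R0 _ H2); pose proof (pow_lt _ n H2).
  pose proof (exp_pos (INR m)); pose proof (sqrt_lt_R0 _ H1); pose proof (pow_lt _ m H1).
  pose proof (stirling_pos m Hm); pose proof (stirling_pos n Hn).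
  field; repeat split; lra.
Qed.

(** With L the unknown limit, stirling(2n) / stirling(n)^2 tends to 1/L. Its square is 2/pi^2 times
    the Wallis sequence, which tends to 1/(2 pi), so L^2 = 2 pi. *)
Lemma stirling_limit : is_lim_seq stirling (sqrt (2 * PI)).
Proof.
  destruct stirling_converges as (L & HL & HS).
  pose proof PI_RGT_0 as HPI.
  assert (H2 : is_lim_seq (fun n => stirling (n + n)) L).
  { apply (is_lim_seq_subseq stirling L (fun n => (n + n)%nat)); [|exact HS].
    apply eventually_subseq; intros n; lia. }
  assert (A : is_lim_seq (fun n => stirling (n + n) / (stirling n * stirling n)) (L / (L * L))).
  { apply is_lim_seq_div'; [exact H2|now apply is_lim_seq_mult'|nra]. }
  assert (A2 : is_lim_seq (fun n => (stirling (n + n) / (stirling n * stirling n)) ^ 2)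
                 (L / (L * L) * (L / (L * L)))).
  { apply (is_lim_seq_ext (fun n => stirling (n + n) / (stirling n * stirling n) *
      (stirling (n + n) / (stirling n * stirling n)))); [intros; ring|].
    now apply is_lim_seq_mult'. }
  assert (B : is_lim_seq (fun n => (stirling (n + n) / (stirling n * stirling n)) ^ 2)
                (2 / PI ^ 2 * (PI / 4))).
  { apply (is_lim_seq_ext_loc (fun n => 2 / PI ^ 2 * (INR n * wallis (2 * n) ^ 2))).
    - exists 1%nat; intros n Hn.
      rewrite wallis_binomial.
      replace (2 * n)%nat with (n + n)%nat by lia.
      rewrite binomial_stirling by lia.
      pose proof (lt_0_INR n ltac:(lia)) as H.
      pose proof (stirling_pos n ltac:(lia)); pose proof (sqrt_lt_R0 _ H); pose proof (pow_lt _ n H).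
      replace (INR n + INR n) with (2 * INR n) by ring.
      rewrite sqrt_mult, Rpow_mult_distr by lra.
      replace (2 ^ (n + n)) with (4 ^ n)
        by (replace (n + n)%nat with (2 * n)%nat by lia; rewrite pow_mult; f_equal; ring).
      rewrite pow_add.
      pose proof (pow_lt 4 n ltac:(lra)).
      pose proof (sqrt_lt_R0 2 ltac:(lra)).
      transitivity (sqrt 2 ^ 2 * INR n / (2 * sqrt (INR n) ^ 2) *
        (stirling (n + n) / (stirling n * stirling n)) ^ 2).
      + field; repeat split; lra.
      + rewrite !pow2_sqrt by lra; field; lra.
    - apply (is_lim_seq_scal_l _ (2 / PI ^ 2) (PI / 4)), wallis_limit. }
  apply is_lim_seq_unique in A2; apply is_lim_seq_unique in B.
  rewrite A2 in B; injection B as E.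
  replace (sqrt (2 * PI)) with L; [exact HS|].
  symmetry; apply sqrt_lem_1; try lra.
  apply Rmult_eq_reg_r with (2 / PI ^ 2 * (PI / 4)).
  - rewrite <- E at 1; field; lra.
  - apply Rgt_not_eq, Rmult_lt_0_compat; apply Rdiv_lt_0_compat; try lra; apply pow_lt; lra.
Qed.

Lemma binomial_asymptotics (k1 k2 : nat) : (0 < k1)%nat -> (0 < k2)%nat ->
  is_lim_seq (fun t => sqrt (INR t) *
      (INR k1 ^ k1 * INR k2 ^ k2 / (INR k1 + INR k2) ^ (k1 + k2)) ^ t *
      Binomial.C (t * k1 + t * k2) (t * k2))
    (/ sqrt (2 * PI) * sqrt ((INR k1 + INR k2) / (INR k1 * INR k2))).
Proof.
  intros H1 H2; pose proof PI_RGT_0 as HPI.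
  pose proof (lt_0_INR k1 H1) as P1; pose proof (lt_0_INR k2 H2) as P2.
  set (s := sqrt ((INR k1 + INR k2) / (INR k1 * INR k2))).
  assert (Sub : forall k, (0 < k)%nat -> is_lim_seq (fun t => stirling (t * k)) (sqrt (2 * PI))).
  { intros k Hk.
    apply (is_lim_seq_subseq stirling _ (fun t => (t * k)%nat)); [|apply stirling_limit].
    apply eventually_subseq; intros n; nia. }
  pose proof (sqrt_lt_R0 (2 * PI) ltac:(lra)) as HL.
  replace (/ sqrt (2 * PI) * s) with
    (sqrt (2 * PI) / (sqrt (2 * PI) * sqrt (2 * PI)) * s) by (field; lra).
  apply (is_lim_seq_ext_loc (fun t =>
    stirling (t * (k1 + k2)) / (stirling (t * k1) * stirling (t * k2)) * s)).
  - exists 1%nat; intros t Ht.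
    pose proof (lt_0_INR t Ht) as Pt.
    assert (Q1 : (0 < t * k1)%nat) by nia; assert (Q2 : (0 < t * k2)%nat) by nia.
    assert (Eb : (INR k1 ^ k1 * INR k2 ^ k2 / (INR k1 + INR k2) ^ (k1 + k2)) ^ t =
      INR k1 ^ (t * k1) * INR k2 ^ (t * k2) / (INR k1 + INR k2) ^ (t * (k1 + k2))).
    { unfold Rdiv; rewrite !Rpow_mult_distr, pow_inv, <- !pow_mult.
      now rewrite (Nat.mul_comm k1), (Nat.mul_comm k2), (Nat.mul_comm (k1 + k2)). }
    rewrite Eb, binomial_stirling by assumption.
    replace (t * (k1 + k2))%nat with (t * k1 + t * k2)%nat by lia.
    pose proof (stirling_pos _ Q1); pose proof (stirling_pos _ Q2).
    rewrite !mult_INR.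
    replace (INR t * INR k1 + INR t * INR k2) with (INR t * (INR k1 + INR k2)) by ring.
    unfold s; rewrite sqrt_div_alt, !sqrt_mult by nra.
    rewrite !Rpow_mult_distr.
    replace (t * k1 + t * k2)%nat with (t * (k1 + k2))%nat by lia.
    replace (INR t ^ (t * (k1 + k2))) with (INR t ^ (t * k1) * INR t ^ (t * k2))
      by (rewrite <- pow_add; f_equal; lia).
    pose proof (sqrt_lt_R0 _ Pt); pose proof (sqrt_lt_R0 _ P1); pose proof (sqrt_lt_R0 _ P2).
    pose proof (pow_lt _ (t * k1) Pt); pose proof (pow_lt _ (t * k2) Pt).
    pose proof (pow_lt _ (t * k1) P1); pose proof (pow_lt _ (t * k2) P2).
    pose proof (pow_lt (INR k1 + INR k2) (t * (k1 + k2)) ltac:(lra)).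
    field; repeat split; lra.
  - apply is_lim_seq_mult'; [|apply is_lim_seq_const].
    apply is_lim_seq_div'; [apply Sub; lia| |nra].
    apply is_lim_seq_mult'; apply Sub; assumption.
Qed.

(** * Ratios of consecutive terms and the tail case (iii) *)

Fixpoint psum (v : nat -> R) (n : nat) : R :=
  match n with O => 0 | S n => psum v n + v n end.

Lemma psum_le (u v : nat -> R) (n : nat) :
  (forall i, (i < n)%nat -> u i <= v i) -> psum u n <= psum v n.
Proof.
  induction n as [|n IH]; intros H; simpl; [lra|].
  pose proof (H n ltac:(lia)); pose proof (IH ltac:(intros; apply H; lia)); lra.
Qed.

Lemma psum_nonneg (u : nat -> R) (n : nat) : (forall i, 0 <= u i) -> 0 <= psum u n.
Proof. intros H; induction n as [|n IH]; simpl; [lra|pose proof (H n); lra]. Qed.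

Lemma Series_psum (v : nat -> R) (n : nat) : ex_series v ->
  ex_series (fun l => v (n + l)%nat) /\ Series v = psum v n + Series (fun l => v (n + l)%nat).
Proof.
  intros Hv; induction n as [|n [IH1 IH2]]; simpl; [split; [exact Hv|now rewrite Rplus_0_l]|].
  assert (E : forall l, v (S (n + l)) = v (n + S l)%nat) by (intros; f_equal; lia).
  split.
  - apply (ex_series_ext (fun l => v (n + S l)%nat)); [intros; now rewrite E|].
    now apply (ex_series_incr_1 (fun l => v (n + l)%nat)).
  - rewrite IH2, Series_incr_1, Nat.add_0_r by exact IH1.
    rewrite (Series_ext _ _ E); ring.
Qed.

Lemma psum_le_Series (v : nat -> R) (n : nat) : (forall i, 0 <= v i) -> ex_series v ->
  psum v n <= Series v.
Proof.
  intros Hp Hv; destruct (Series_psum v n Hv) as [H1 H2].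
  enough (0 <= Series (fun l => v (n + l)%nat)) by lra.
  rewrite <- (Rmult_0_l (Series (fun l => v (n + l)%nat))), <- Series_scal_l.
  apply Series_le; [|exact H1]; intros l; pose proof (Hp (n + l)%nat); lra.
Qed.

Lemma Series_le_geom (u : nat -> R) (s : R) : 0 <= s < 1 -> (forall l, 0 <= u l) ->
  (forall l, u (S l) <= s * u l) -> Series u <= u 0%nat / (1 - s).
Proof.
  intros Hs Hp Hu.
  unfold Rdiv; rewrite <- Series_geom by (rewrite Rabs_pos_eq; lra).
  rewrite <- Series_scal_l; apply Series_le.
  - intros l; split; [apply Hp|].
    induction l as [|l IH]; [simpl; lra|].
    eapply Rle_trans; [apply Hu|]; simpl.
    replace (u 0%nat * (s * s ^ l)) with (s * (u 0%nat * s ^ l)) by ring.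
    apply Rmult_le_compat_l; lra.
  - apply (ex_series_scal_l (V := R_NormedModule) (u 0%nat) (fun l => s ^ l)), ex_series_geom; rewrite Rabs_pos_eq; lra.
Qed.

Lemma psum_le_geom (v : nat -> R) (s : R) (n : nat) : 1 < s -> 0 <= v 0%nat ->
  (forall m, (m < n)%nat -> s * v m <= v (S m)) -> psum v n <= v n / (s - 1).
Proof.
  intros Hs H0 Hv; induction n as [|n IH]; simpl.
  - apply Rdiv_le_0_compat; lra.
  - pose proof (IH ltac:(intros; apply Hv; lia)) as I; pose proof (Hv n ltac:(lia)) as J.
    apply Rle_trans with (s * v n / (s - 1)).
    + replace (s * v n / (s - 1)) with (v n / (s - 1) + v n) by (field; lra); lra.
    + apply Rmult_le_compat_r; [left; apply Rinv_0_lt_compat; lra|exact J].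
Qed.

(* The ratio of consecutive terms up to a factor [1 - 1/(2x + d)]; decreasing in [x], and equal to [qq] at [x = b]. *)
Definition profile (r d x : R) : R := (2 * x + d) ^ 2 / (x * (x + d) * r ^ 2).

Lemma green_ratio (d : nat) (r : R) (m : nat) : 0 < r ->
  green d r (S m) =
  profile r (INR d) (INR (S m)) * (1 - / (2 * INR (S m) + INR d)) * green d r m.
Proof.
  intros Hr; unfold green, profile, Binomial.C.
  replace (2 * S m + d - S m)%nat with (S (m + d)) by lia.
  replace (2 * m + d - m)%nat with (m + d)%nat by lia.
  replace (2 * S m + d)%nat with (S (S (2 * m + d))) by lia.
  rewrite !fact_simpl, !mult_INR, !S_INR, !plus_INR, mult_INR.
  change (INR 2) with 2; simpl pow.
  pose proof (pos_INR m); pose proof (pos_INR d).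
  pose proof (INR_fact_neq_0 m); pose proof (INR_fact_neq_0 (m + d)).
  pose proof (pow_lt r (2 * m + d) Hr).
  simpl pow in *; field; repeat split; try lra.
Qed.

(** From (2x + d)^2 = 4x(x + d) + d^2; in this form the monotonicity in [x] is visible. *)
Lemma profile_eq (r d x : R) : 0 < r -> 0 < x -> 0 <= d ->
  profile r d x = (4 + d ^ 2 / (x * (x + d))) / r ^ 2.
Proof. intros; unfold profile; field; repeat split; nra. Qed.

Lemma profile_decr (r d x y : R) : 0 < r -> 0 < x <= y -> 0 <= d ->
  profile r d y <= profile r d x.
Proof.
  intros Hr Hx Hd; rewrite !profile_eq by lra.
  apply Rmult_le_compat_r; [left; apply Rinv_0_lt_compat, pow_lt; lra|].
  apply Rplus_le_compat_l, Rmult_le_compat_l; [apply pow2_ge_0|].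
  apply Rinv_le_contravar; nra.
Qed.

Lemma profile_pos (r d x : R) : 0 < r -> 0 < x -> 0 <= d -> 0 < profile r d x.
Proof.
  intros; unfold profile; apply Rdiv_lt_0_compat; [apply pow_lt; lra|].
  apply Rmult_lt_0_compat; [nra|apply pow_lt; lra].
Qed.

Lemma profile_qq (r : R) (k1 k2 t : nat) : 0 < r -> (k2 <= k1)%nat -> (0 < k2)%nat -> (0 < t)%nat ->
  profile r (INR (t * k1 - t * k2)) (INR (t * k2)) = qq r k1 k2.
Proof.
  intros Hr H12 H2 Ht; unfold profile, qq.
  rewrite minus_INR, !mult_INR by nia.
  pose proof (lt_0_INR t Ht); pose proof (lt_0_INR k2 H2); pose proof (lt_0_INR k1 ltac:(lia)).
  replace (2 * (INR t * INR k2) + (INR t * INR k1 - INR t * INR k2))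
    with (INR t * (INR k1 + INR k2)) by ring.
  replace (INR t * INR k2 + (INR t * INR k1 - INR t * INR k2)) with (INR t * INR k1) by ring.
  field; repeat split; lra.
Qed.

Lemma green_le_ratio (d : nat) (r : R) (b m : nat) : 0 < r -> (0 < b <= S m)%nat ->
  green d r (S m) <= profile r (INR d) (INR b) * green d r m.
Proof.
  intros Hr Hb; rewrite green_ratio by assumption.
  pose proof (green_pos d r m Hr); pose proof (pos_INR d).
  pose proof (lt_0_INR b ltac:(lia)); pose proof (le_INR b (S m) ltac:(lia)).
  pose proof (profile_decr r (INR d) (INR b) (INR (S m)) Hr ltac:(lra) ltac:(lra)).
  pose proof (profile_pos r (INR d) (INR (S m)) Hr ltac:(lra) ltac:(lra)).
  pose proof (Rinv_0_lt_compat (2 * INR (S m) + INR d) ltac:(lra)).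
  apply Rmult_le_compat_r; [lra|]; nra.
Qed.

(** The correction 1/(2x + d) is at most 1/d whatever the index, so up to [b] the growth factor has
    one lower bound, close to the profile at [b] once [d] is large. *)
Lemma green_ge_ratio (d : nat) (r : R) (b m : nat) : 0 < r -> (0 < d)%nat -> (S m <= b)%nat ->
  profile r (INR d) (INR b) * (1 - / INR d) * green d r m <= green d r (S m).
Proof.
  intros Hr Hd Hb; rewrite green_ratio by assumption.
  pose proof (green_pos d r m Hr).
  pose proof (lt_0_INR (S m) ltac:(lia)); pose proof (le_INR (S m) b ltac:(lia)).
  assert (1 <= INR d) by (apply (le_INR 1); lia).
  pose proof (profile_decr r (INR d) (INR (S m)) (INR b) Hr ltac:(lra) ltac:(lra)).
  pose proof (profile_pos r (INR d) (INR b) Hr ltac:(lra) ltac:(lra)).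
  pose proof (Rinv_le_contravar (INR d) (2 * INR (S m) + INR d) ltac:(lra) ltac:(lra)).
  assert (/ INR d <= 1) by (rewrite <- Rinv_1; apply Rinv_le_contravar; lra).
  apply Rmult_le_compat_r; [lra|].
  apply Rmult_le_compat; lra.
Qed.

Definition kappa (k1 k2 : nat) : R :=
  INR k1 ^ k1 * INR k2 ^ k2 / (INR k1 + INR k2) ^ (k1 + k2).

(** The power of [kappa] cancels the exponential growth of the binomial coefficient: [kappa] is the
    exponential of minus (k1 + k2) times the entropy of the proportions k1 : k2. No [r] occurs, so
    bounds on this quantity are automatically uniform in [r]. *)
Definition scaled_binomial (k1 k2 t : nat) : R :=
  kappa k1 k2 ^ t * Binomial.C (t * k1 + t * k2) (t * k2).

Lemma kappa_pos (k1 k2 : nat) : (0 < k1)%nat -> (0 < k2)%nat -> 0 < kappa k1 k2.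
Proof.
  intros H1 H2; pose proof (lt_0_INR k1 H1); pose proof (lt_0_INR k2 H2).
  apply Rdiv_lt_0_compat; [apply Rmult_lt_0_compat|]; apply pow_lt; lra.
Qed.

Lemma green_edge (r : R) (k1 k2 t : nat) : (k2 <= k1)%nat ->
  green (t * k1 - t * k2) r (t * k2) =
  Binomial.C (t * k1 + t * k2) (t * k2) / (r ^ (k1 + k2)) ^ t.
Proof.
  intros H; unfold green; rewrite <- pow_mult.
  replace (2 * (t * k2) + (t * k1 - t * k2))%nat with (t * k1 + t * k2)%nat by nia.
  now replace ((k1 + k2) * t)%nat with (t * k1 + t * k2)%nat by lia.
Qed.

Lemma base1_green_edge (r : R) (k1 k2 t : nat) : 0 < r -> (k2 <= k1)%nat ->
  base1 r k1 k2 ^ t * green (t * k1 - t * k2) r (t * k2) = scaled_binomial k1 k2 t.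
Proof.
  intros Hr H; rewrite green_edge by assumption; unfold scaled_binomial.
  replace (base1 r k1 k2) with (r ^ (k1 + k2) * kappa k1 k2)
    by (unfold base1, kappa, Rdiv; ring).
  rewrite Rpow_mult_distr; field; apply pow_nonzero, pow_nonzero; lra.
Qed.

Lemma pow_le_exp (x : R) (k : nat) : 0 <= x -> x ^ k <= exp (INR k * (x - 1)).
Proof.
  intros Hx; induction k as [|k IH].
  - simpl; rewrite Rmult_0_l, exp_0; lra.
  - rewrite S_INR; replace ((INR k + 1) * (x - 1)) with ((x - 1) + INR k * (x - 1)) by ring.
    rewrite exp_plus; simpl; apply Rmult_le_compat; [lra|now apply pow_le| |exact IH].
    pose proof (exp_ineq1_le (x - 1)); lra.
Qed.

(* Gibbs' inequality between the distributions (k1, k2)/(k1 + k2) and (1, rho^2)/(1 + rho^2). *)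
Lemma kappa_ge (r : R) (k1 k2 : nat) : 2 < r -> (k2 <= k1)%nat -> (0 < k2)%nat ->
  1 <= kappa k1 k2 * (r ^ (k1 + k2) * rho r ^ (k1 - k2)).
Proof.
  intros Hr H12 H2.
  pose proof (rho_bounds r Hr) as Hb; pose proof (rho_eq r Hr) as He.
  pose proof (lt_0_INR k2 H2) as P2; pose proof (lt_0_INR k1 ltac:(lia)) as P1.
  set (x := rho r) in *; set (K := INR k1 + INR k2).
  assert (Hx : 0 < x ^ 2) by (apply pow_lt; lra).
  assert (E : r ^ (k1 + k2) * x ^ (k1 - k2) * (x ^ 2) ^ k2 = (1 + x ^ 2) ^ (k1 + k2)).
  { rewrite <- He, Rpow_mult_distr, <- pow_mult, Rmult_assoc, <- pow_add.
    f_equal; f_equal; lia. }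
  pose proof (pow_le_exp (K / (INR k1 * (1 + x ^ 2))) k1) as L1.
  pose proof (pow_le_exp (K * x ^ 2 / (INR k2 * (1 + x ^ 2))) k2) as L2.
  (* [y1] and [y2] are the likelihood ratios of the two distributions. Both distributions have mass
     1, so the exponents k1 (y1 - 1) and k2 (y2 - 1) below add up to 0. *)
  set (y1 := K / (INR k1 * (1 + x ^ 2))) in *.
  set (y2 := K * x ^ 2 / (INR k2 * (1 + x ^ 2))) in *.
  assert (Y1 : 0 < y1) by (apply Rdiv_lt_0_compat; unfold K; nra).
  assert (Y2 : 0 < y2) by (apply Rdiv_lt_0_compat; unfold K; nra).
  assert (L : y1 ^ k1 * y2 ^ k2 <= 1).
  { apply Rle_trans with (exp (INR k1 * (y1 - 1)) * exp (INR k2 * (y2 - 1))).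
    - apply Rmult_le_compat; try (apply pow_le; lra); [apply L1|apply L2]; lra.
    - rewrite <- exp_plus.
      replace (INR k1 * (y1 - 1) + INR k2 * (y2 - 1)) with 0; [rewrite exp_0; lra|].
      unfold y1, y2, K; field; lra. }
  assert (E2 : y1 ^ k1 * y2 ^ k2 * (kappa k1 k2 * (r ^ (k1 + k2) * x ^ (k1 - k2))) = 1).
  { pose proof (pow_lt (x ^ 2) k2 Hx).
    assert (E3 : r ^ (k1 + k2) * x ^ (k1 - k2) = (1 + x ^ 2) ^ (k1 + k2) / (x ^ 2) ^ k2)
      by (rewrite <- E; field; lra).
    rewrite E3; unfold y1, y2, kappa; fold K.
    unfold Rdiv; rewrite !Rpow_mult_distr, !pow_inv, !Rpow_mult_distr, !pow_add.
    assert (0 < K) by (unfold K; lra).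
    pose proof (pow_lt _ k1 P1); pose proof (pow_lt _ k2 P2).
    pose proof (pow_lt K k1 ltac:(assumption)); pose proof (pow_lt K k2 ltac:(assumption)).
    pose proof (pow_lt (1 + x ^ 2) k1 ltac:(lra)); pose proof (pow_lt (1 + x ^ 2) k2 ltac:(lra)).
    field; repeat split; lra. }
  assert (0 < kappa k1 k2 * (r ^ (k1 + k2) * x ^ (k1 - k2))).
  { apply Rmult_lt_0_compat; [apply kappa_pos; lia|].
    apply Rmult_lt_0_compat; apply pow_lt; lra. }
  assert (0 < y1 ^ k1 * y2 ^ k2) by (apply Rmult_lt_0_compat; apply pow_lt; lra).
  nra.
Qed.

(** The [t]-th power of Gibbs' bound. The right side no longer depends on [r] and is O(1 / sqrt
    t). *)
Lemma green_edge_le (r : R) (k1 k2 t : nat) : 2 < r -> (k2 <= k1)%nat -> (0 < k2)%nat ->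
  green (t * k1 - t * k2) r (t * k2) / rho r ^ (t * (k1 - k2)) <= scaled_binomial k1 k2 t.
Proof.
  intros Hr H12 H2.
  pose proof (rho_bounds r Hr) as Hb.
  pose proof (kappa_ge r k1 k2 Hr H12 H2) as HK.
  rewrite green_edge by assumption; unfold scaled_binomial.
  pose proof (binomial_pos (t * k1 + t * k2) (t * k2)) as HC.
  set (Z := r ^ (k1 + k2) * rho r ^ (k1 - k2)) in *.
  assert (HZ : 0 < Z) by (apply Rmult_lt_0_compat; apply pow_lt; lra).
  replace (rho r ^ (t * (k1 - k2))) with ((rho r ^ (k1 - k2)) ^ t)
    by (rewrite <- pow_mult; f_equal; lia).
  replace (Binomial.C (t * k1 + t * k2) (t * k2) / (r ^ (k1 + k2)) ^ t / (rho r ^ (k1 - k2)) ^ t)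
    with ((/ Z) ^ t * Binomial.C (t * k1 + t * k2) (t * k2)).
  - apply Rmult_le_compat_r; [lra|].
    pose proof (Rinv_0_lt_compat _ HZ).
    apply pow_incr; split; [lra|].
    apply Rmult_le_reg_r with Z; [lra|]; rewrite Rinv_l; lra.
  - unfold Z; rewrite pow_inv, Rpow_mult_distr; field.
    split; apply pow_nonzero, pow_nonzero; lra.
Qed.

Lemma scaled_binomial_limit (k1 k2 : nat) : (0 < k1)%nat -> (0 < k2)%nat ->
  is_lim_seq (fun t => sqrt (INR t) * scaled_binomial k1 k2 t)
    (/ sqrt (2 * PI) * sqrt ((INR k1 + INR k2) / (INR k1 * INR k2))).
Proof.
  intros H1 H2; eapply is_lim_seq_ext; [|exact (binomial_asymptotics k1 k2 H1 H2)].
  intros t; unfold scaled_binomial, kappa; simpl; ring.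
Qed.

Lemma scaled_binomial_le (k1 k2 : nat) : (0 < k1)%nat -> (0 < k2)%nat ->
  exists M, 0 < M /\ forall t, (0 < t)%nat -> scaled_binomial k1 k2 t <= M / sqrt (INR t).
Proof.
  intros H1 H2.
  destruct (filterlim_bounded (K := R_AbsRing) (V := R_NormedModule)
    (fun t => sqrt (INR t) * scaled_binomial k1 k2 t)) as [M HM].
  { eexists; apply (scaled_binomial_limit k1 k2 H1 H2). }
  exists (Rabs M + 1); split; [pose proof (Rabs_pos M); lra|].
  intros t Ht; pose proof (sqrt_lt_R0 _ (lt_0_INR t Ht)) as Hs.
  apply Rmult_le_reg_l with (sqrt (INR t)); [exact Hs|].
  replace (sqrt (INR t) * ((Rabs M + 1) / sqrt (INR t))) with (Rabs M + 1) by (field; lra).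
  specialize (HM t); unfold norm in HM; simpl in HM; unfold abs in HM; simpl in HM.
  pose proof (Rle_abs (sqrt (INR t) * scaled_binomial k1 k2 t)); pose proof (Rle_abs M); lra.
Qed.

Lemma ct_green (r : R) (k1 k2 t : nat) : 2 < r -> (k2 <= k1)%nat ->
  ct r k1 k2 t = RtoC (Series (fun l => green (t * k1 - t * k2) r (t * k2 + l))).
Proof.
  intros Hr H; unfold ct.
  destruct (c_green r (t * k1) (t * k2) Hr ltac:(nia)) as (S & HS & ->).
  f_equal; symmetry; now apply is_series_unique.
Qed.

(** Replaces the tail by the complete series minus its head, so that (ii) and (iii) become
    statements about the finite sum below the edge. *)
Lemma seq23_green (r : R) (k1 k2 t : nat) : 2 < r -> (k2 <= k1)%nat ->
  seq23 r k1 k2 t =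
  RtoC (lim3 r - psum (green (t * k1 - t * k2) r) (t * k2) / rho r ^ (t * (k1 - k2))).
Proof.
  intros Hr H; pose proof (rho_bounds r Hr) as Hb.
  assert (Hp : rho r ^ (t * (k1 - k2)) <> 0) by (apply pow_nonzero; lra).
  unfold seq23; rewrite ct_green by assumption.
  rewrite <- RtoC_div by exact Hp; f_equal.
  destruct (Series_psum (green (t * k1 - t * k2) r) (t * k2)) as [_ E];
    [now apply ex_series_green|].
  rewrite Series_green in E by assumption.
  replace (t * k1 - t * k2)%nat with (t * (k1 - k2))%nat in * by nia.
  apply Rmult_eq_reg_r with (rho r ^ (t * (k1 - k2))); [|exact Hp].
  field_simplify; [|exact Hp|exact Hp].
  lra.
Qed.

Lemma inv_sqrt_small (M eps : R) : 0 < M -> 0 < eps ->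
  exists N, (0 < N)%nat /\ forall t, (N <= t)%nat -> M / sqrt (INR t) < eps.
Proof.
  intros HM He.
  destruct (INR_unbounded ((M / eps) ^ 2)) as [N HN].
  assert (H0 : 0 < M / eps) by (apply Rdiv_lt_0_compat; lra).
  exists (S N); split; [lia|]; intros t Ht.
  assert (Ht' : (M / eps) ^ 2 < INR t) by (pose proof (le_INR N t ltac:(lia)); lra).
  assert (Hs : M / eps < sqrt (INR t)).
  { rewrite <- (sqrt_pow2 (M / eps)) by lra; apply sqrt_lt_1_alt; split; [apply pow2_ge_0|exact Ht']. }
  apply Rmult_lt_reg_r with (sqrt (INR t)); [lra|].
  replace (M / sqrt (INR t) * sqrt (INR t)) with (M / eps * eps) by (field; lra).
  nra.
Qed.

Lemma seq23_tail_uniform (k1 k2 : nat) (q : R) : (k2 <= k1)%nat -> (0 < k2)%nat -> 1 < q ->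
  forall eps, 0 < eps -> exists N, forall t, (N <= t)%nat -> forall r, 2 < r -> q <= qq r k1 k2 ->
    Cmod (seq23 r k1 k2 t - RtoC (lim3 r))%C < eps.
Proof.
  intros H12 H2 Hq eps He.
  destruct (scaled_binomial_le k1 k2) as (M & HM & HB); try lia.
  destruct (inv_sqrt_small (2 * M / (q - 1)) eps) as (N1 & HN1 & HN); [|exact He|].
  { apply Rdiv_lt_0_compat; lra. }
  (* Beyond this threshold q/d <= (q - 1)/2, so that q (1 - 1/d) is still at least [s], the midpoint
     of 1 and [q]; then 1/(s - 1) = 2/(q - 1) explains the constant above. *)
  destruct (INR_unbounded (2 * q / (q - 1))) as [N2 HN2].
  exists (N1 + N2)%nat; intros t Ht r Hr Hqr.
  (* For equal indices [qq] is (2/r)^2 < 1. Strictness makes [d] at least [t], hence unbounded. *)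
  assert (Hk : (k2 < k1)%nat).
  { destruct (Nat.eq_dec k1 k2) as [->|]; [|lia]; exfalso.
    pose proof (lt_0_INR k2 H2).
    assert (qq r k2 k2 < 1); [|lra].
    replace (qq r k2 k2) with ((2 / r) ^ 2) by (unfold qq; field; split; lra).
    apply sq_ratio_lt_1; lra. }
  assert (Ht0 : (0 < t)%nat) by lia.
  pose proof (rho_bounds r Hr) as Hb.
  set (d := (t * k1 - t * k2)%nat).
  assert (Hd : (t <= d)%nat) by (unfold d; nia).
  assert (Hd' : 2 * q / (q - 1) < INR d)
    by (pose proof (le_INR N2 d ltac:(lia)); lra).
  set (s := (1 + q) / 2).
  assert (Hs : s <= q * (1 - / INR d)).
  { assert (0 < 2 * q / (q - 1)) by (apply Rdiv_lt_0_compat; lra).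
    assert (q * / INR d <= (q - 1) / 2).
    { apply Rle_trans with (q * / (2 * q / (q - 1))); [|right; field; lra].
      apply Rmult_le_compat_l; [lra|]; apply Rinv_le_contravar; lra. }
    unfold s; lra. }
  assert (G : psum (green d r) (t * k2) <= green d r (t * k2) / (s - 1)).
  { apply psum_le_geom; [unfold s; lra|left; apply green_pos; lra|].
    intros m Hm.
    eapply Rle_trans; [|apply (green_ge_ratio d r (t * k2) m); lra || lia].
    apply Rmult_le_compat_r; [left; apply green_pos; lra|].
    unfold d at 1; rewrite profile_qq by (lra || lia).
    eapply Rle_trans; [exact Hs|]; apply Rmult_le_compat_r; [|exact Hqr].
    pose proof (Rinv_le_contravar 1 (INR d) ltac:(lra) ltac:(apply (le_INR 1); lia)) as Q.
    rewrite Rinv_1 in Q; lra. }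
  rewrite seq23_green, <- RtoC_minus, Cmod_R by (lra || lia); fold d.
  set (w := rho r ^ (t * (k1 - k2))).
  assert (Hw : 0 < w) by (apply pow_lt; lra).
  pose proof (psum_nonneg (green d r) (t * k2) ltac:(intros; left; apply green_pos; lra)) as P0.
  replace (lim3 r - psum (green d r) (t * k2) / w - lim3 r)
    with (- (psum (green d r) (t * k2) / w)) by ring.
  rewrite Rabs_Ropp, Rabs_pos_eq by (apply Rdiv_le_0_compat; lra).
  eapply Rle_lt_trans; [|apply (HN t ltac:(lia))].
  apply Rle_trans with (green d r (t * k2) / w * (2 / (q - 1))).
  - replace (green d r (t * k2) / w * (2 / (q - 1)))
      with (green d r (t * k2) / (s - 1) / w) by (unfold s; field; lra).
    apply Rmult_le_compat_r; [left; now apply Rinv_0_lt_compat|exact G].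
  - replace (2 * M / (q - 1) / sqrt (INR t)) with (M / sqrt (INR t) * (2 / (q - 1))).
    2:{ pose proof (sqrt_lt_R0 _ (lt_0_INR t Ht0)); field; lra. }
    apply Rmult_le_compat_r; [left; apply Rdiv_lt_0_compat; lra|].
    eapply Rle_trans; [apply green_edge_le; lra || lia|apply HB; lia].
Qed.

(** * The edge-dominated case (i) *)

Lemma green_ratio_lower (d : nat) (r : R) (b l : nat) : 0 < r -> (0 < b)%nat ->
  profile r (INR d) (INR b) * (1 - 2 * INR (S l) / INR b) * green d r (b + l) <=
  green d r (S (b + l)).
Proof.
  intros Hr Hb; rewrite green_ratio by assumption.
  apply Rmult_le_compat_r; [left; now apply green_pos|].
  replace (S (b + l)) with (b + S l)%nat by lia; rewrite plus_INR.
  pose proof (pos_INR d) as Pd; pose proof (lt_0_INR b Hb) as Pb.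
  assert (Px : 1 <= INR (S l)) by (apply (le_INR 1); lia).
  set (x := INR (S l)) in *; set (B := INR b) in *; set (D := INR d) in *.
  assert (H2 : 0 < r ^ 2) by (now apply pow_lt).
  assert (HS : 0 < (B + x) * (B + x + D)) by nra.
  (* With n = 2(B + x) + D and [x >= 1], the exact numerator n(n - 1) already exceeds (2B + D)^2.
     This absorbs the correction factor, and only denominators remain to be compared. *)
  apply Rle_trans with ((2 * B + D) ^ 2 / ((B + x) * (B + x + D) * r ^ 2)).
  - unfold profile.
    replace ((2 * B + D) ^ 2 / (B * (B + D) * r ^ 2) * (1 - 2 * x / B)) with
      ((2 * B + D) ^ 2 / r ^ 2 * ((B - 2 * x) / (B * B * (B + D)))) by (field; repeat split; nra).
    replace ((2 * B + D) ^ 2 / ((B + x) * (B + x + D) * r ^ 2)) with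
      ((2 * B + D) ^ 2 / r ^ 2 * / ((B + x) * (B + x + D))) by (field; repeat split; nra).
    apply Rmult_le_compat_l.
    + apply Rdiv_le_0_compat; [apply pow2_ge_0|exact H2].
    + assert (HB : 0 < B * B * (B + D)) by (apply Rmult_lt_0_compat; nra).
      apply Rmult_le_reg_r with (B * B * (B + D) * ((B + x) * (B + x + D)));
        [now apply Rmult_lt_0_compat|].
      replace ((B - 2 * x) / (B * B * (B + D)) * (B * B * (B + D) * ((B + x) * (B + x + D))))
        with ((B - 2 * x) * ((B + x) * (B + x + D))) by (field; repeat split; nra).
      replace (/ ((B + x) * (B + x + D)) * (B * B * (B + D) * ((B + x) * (B + x + D))))
        with (B * B * (B + D)) by (field; repeat split; nra).
      enough (0 <= 3 * B * x * x + 2 * x * x * x + D * (B * x + 2 * x * x)) by lra.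
      assert (0 <= B * x) by nra; assert (0 <= x * x) by nra.
      assert (0 <= B * x * x) by nra; assert (0 <= x * x * x) by nra.
      nra.
  - unfold profile.
    replace ((2 * (B + x) + D) ^ 2 / ((B + x) * (B + x + D) * r ^ 2) * (1 - / (2 * (B + x) + D)))
      with ((2 * (B + x) + D) * (2 * (B + x) + D - 1) / ((B + x) * (B + x + D) * r ^ 2))
      by (field; repeat split; nra).
    apply Rmult_le_compat_r; [left; apply Rinv_0_lt_compat; nra|nra].
Qed.

(** The product of the factors 1 - 2i/b for i = 1, ..., l is at least 1 minus the sum of the 2i/b,
    that is 1 - l(l + 1)/b, as long as the factors are nonnegative. *)
Lemma green_lower (d : nat) (r : R) (b l : nat) : 0 < r -> (0 < b)%nat ->
  green d r b * (profile r (INR d) (INR b) ^ l * (1 - INR l * INR (S l) / INR b)) <=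
  green d r (b + l).
Proof.
  intros Hr Hb.
  pose proof (lt_0_INR b Hb) as Pb; pose proof (pos_INR d) as Pd.
  pose proof (profile_pos r (INR d) (INR b) Hr Pb Pd) as PQ.
  set (Q := profile r (INR d) (INR b)) in *.
  (* A nonpositive bound holds trivially. Splitting it off leaves x(x + 1) < b with [x >= 1], which
     guarantees that the factor 1 - 2x/b is nonnegative. *)
  assert (H0 : forall l, 1 - INR l * INR (S l) / INR b <= 0 ->
    green d r b * (Q ^ l * (1 - INR l * INR (S l) / INR b)) <= green d r (b + l)).
  { intros k Hk; apply Rle_trans with 0; [|left; now apply green_pos].
    pose proof (green_pos d r b Hr); pose proof (pow_lt Q k PQ).
    assert (Q ^ k * (1 - INR k * INR (S k) / INR b) <= 0) by nra; nra. }
  induction l as [|l IH].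
  - simpl INR; rewrite Nat.add_0_r; simpl; unfold Rdiv; rewrite !Rmult_0_l; lra.
  - destruct (Rle_dec (1 - INR (S l) * INR (S (S l)) / INR b) 0) as [Hn|Hn]; [now apply H0|].
    pose proof (pos_INR l) as Pl.
    set (x := INR (S l)) in *.
    assert (Ex : INR (S l) = INR l + 1) by apply S_INR.
    assert (Ex2 : INR (S (S l)) = x + 1) by apply S_INR.
    fold x in Ex; rewrite Ex2 in *.
    assert (U : x * (x + 1) < INR b).
    { apply Rmult_lt_reg_r with (/ INR b); [now apply Rinv_0_lt_compat|].
      rewrite Rinv_r by lra; unfold Rdiv in Hn; lra. }
    assert (A1 : 0 <= 1 - 2 * x / INR b).
    { apply Rmult_le_reg_r with (INR b); [exact Pb|]; field_simplify; nra. }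
    rewrite Nat.add_succ_r.
    eapply Rle_trans; [|now apply green_ratio_lower]; fold Q x.
    apply Rle_trans with (Q * (1 - 2 * x / INR b) *
      (green d r b * (Q ^ l * (1 - INR l * x / INR b)))).
    2:{ apply Rmult_le_compat_l; [apply Rmult_le_pos; lra|exact IH]. }
    pose proof (green_pos d r b Hr); pose proof (pow_lt Q l PQ).
    replace (green d r b * (Q ^ S l * (1 - x * (x + 1) / INR b))) with
      (green d r b * (Q * Q ^ l) * (1 - x * (x + 1) / INR b)) by (simpl; ring).
    replace (Q * (1 - 2 * x / INR b) * (green d r b * (Q ^ l * (1 - INR l * x / INR b)))) with
      (green d r b * (Q * Q ^ l) * ((1 - 2 * x / INR b) * (1 - INR l * x / INR b))) by ring.
    apply Rmult_le_compat_l; [apply Rmult_le_pos; nra|].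
    replace ((1 - 2 * x / INR b) * (1 - INR l * x / INR b)) with
      (1 - x * (x + 1) / INR b + 2 * x / INR b * (INR l * x / INR b)) by (rewrite Ex; field; lra).
    enough (0 <= 2 * x / INR b * (INR l * x / INR b)) by lra.
    apply Rmult_le_pos; apply Rdiv_le_0_compat; nra.
Qed.

(* The correction comes from [sum_{l >= 0} l (l + 1) Q^l = 2 Q / (1 - Q)^3]. *)
Lemma psum_geom_correction (Q B : R) (n : nat) : 0 <= Q < 1 -> 0 < B ->
  (1 - Q ^ n) / (1 - Q) - 2 * Q / ((1 - Q) ^ 3 * B) <=
  psum (fun l => Q ^ l * (1 - INR l * INR (S l) / B)) n.
Proof.
  intros HQ HB.
  (* The exact partial sum is what makes the induction close; its remainder carrying [Q ^ n] is
     nonnegative and is then dropped. *)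
  assert (E : psum (fun l => Q ^ l * (1 - INR l * INR (S l) / B)) n =
    (1 - Q ^ n) / (1 - Q) - (2 * Q / (1 - Q) ^ 3 - Q ^ n * (INR n ^ 2 / (1 - Q) +
      (1 + Q) / (1 - Q) ^ 2 * INR n + 2 * Q / (1 - Q) ^ 3)) / B).
  { induction n as [|n IH].
    - simpl; field; lra.
    - cbn [psum]; rewrite IH, S_INR; simpl pow; field; lra. }
  rewrite E.
  pose proof (pos_INR n) as Pn.
  assert (P3 : 0 < (1 - Q) ^ 3) by (apply pow_lt; lra).
  assert (P2 : 0 < (1 - Q) ^ 2) by (apply pow_lt; lra).
  assert (G : 0 <= Q ^ n * (INR n ^ 2 / (1 - Q) + (1 + Q) / (1 - Q) ^ 2 * INR n + 2 * Q / (1 - Q) ^ 3)).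
  { apply Rmult_le_pos; [apply pow_le; lra|].
    repeat apply Rplus_le_le_0_compat.
    - apply Rdiv_le_0_compat; [apply pow2_ge_0|lra].
    - apply Rmult_le_pos; [apply Rdiv_le_0_compat|]; lra.
    - apply Rdiv_le_0_compat; lra. }
  apply Rmult_le_compat_r with (r := / B) in G; [|left; now apply Rinv_0_lt_compat].
  replace (2 * Q / ((1 - Q) ^ 3 * B)) with (2 * Q / (1 - Q) ^ 3 / B) by (field; split; lra).
  unfold Rdiv in *; lra.
Qed.

(** The two bounds differ by a relative error of order 1/b whose constant depends on [Q] alone, so
    the estimate is uniform as long as [Q] stays away from 1. *)
Lemma Series_green_edge_bounds (d : nat) (r : R) (b : nat) : 2 < r -> (0 < b)%nat ->
  profile r (INR d) (INR b) < 1 ->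
  let Q := profile r (INR d) (INR b) in
  green d r b * (/ (1 - Q) - 2 * Q / ((1 - Q) ^ 3 * INR b)) <=
    Series (fun l => green d r (b + l)) <= green d r b / (1 - Q).
Proof.
  intros Hr Hb HQ Q.
  pose proof (lt_0_INR b Hb) as Pb; pose proof (pos_INR d) as Pd.
  pose proof (profile_pos r (INR d) (INR b) ltac:(lra) Pb Pd) as PQ; fold Q in HQ, PQ.
  pose proof (green_pos d r b ltac:(lra)) as G0.
  destruct (Series_psum (green d r) b (ex_series_green d r Hr)) as [Ex _].
  split.
  - assert (L : is_lim_seq (fun n => green d r b * ((1 - Q ^ n) / (1 - Q) - 2 * Q / ((1 - Q) ^ 3 * INR b)))
       (green d r b * (/ (1 - Q) - 2 * Q / ((1 - Q) ^ 3 * INR b)))).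
    { apply (is_lim_seq_scal_l _ _ (Finite _)), is_lim_seq_minus'; [|apply is_lim_seq_const].
      replace (/ (1 - Q)) with ((1 - 0) / (1 - Q)) by (field; lra).
      apply (is_lim_seq_scal_r _ _ (Finite _)), is_lim_seq_minus'; [apply is_lim_seq_const|].
      apply is_lim_seq_geom; rewrite Rabs_pos_eq; lra. }
    refine (is_lim_seq_le _ (fun _ => Series (fun l => green d r (b + l))) _ (Finite _) _ L
              (is_lim_seq_const _)).
    intros n.
    apply Rle_trans with (psum (fun l => green d r (b + l)) n).
    + apply Rle_trans with (green d r b * psum (fun l => Q ^ l * (1 - INR l * INR (S l) / INR b)) n).
      * apply Rmult_le_compat_l; [lra|]; apply psum_geom_correction; lra.
      * assert (S1 : forall k, green d r b * psum (fun l => Q ^ l * (1 - INR l * INR (S l) / INR b)) k =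
          psum (fun l => green d r b * (Q ^ l * (1 - INR l * INR (S l) / INR b))) k).
        { induction k as [|k IH]; cbn [psum]; [ring|rewrite Rmult_plus_distr_l, IH; ring]. }
        rewrite S1; apply psum_le; intros l _; apply green_lower; lra || lia.
    + apply psum_le_Series; [intros; left; apply green_pos; lra|exact Ex].
  - replace (green d r b) with (green d r (b + 0)) by (f_equal; lia).
    apply (Series_le_geom (fun l => green d r (b + l)) Q); [lra| |].
    + intros; left; apply green_pos; lra.
    + intros l; rewrite Nat.add_succ_r; apply green_le_ratio; lra || lia.
Qed.

Lemma seq1_uniform (k1 k2 : nat) (q : R) : (k2 <= k1)%nat -> (0 < k2)%nat -> q < 1 ->
  forall eps, 0 < eps -> exists N, forall t, (N <= t)%nat -> forall r, 2 < r -> qq r k1 k2 <= q ->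
    Cmod (seq1 r k1 k2 t - RtoC (lim1 r k1 k2))%C < eps.
Proof.
  intros H12 H2 Hq eps He.
  pose proof (scaled_binomial_limit k1 k2 ltac:(lia) H2) as HL.
  set (L := / sqrt (2 * PI) * sqrt ((INR k1 + INR k2) / (INR k1 * INR k2))) in *.
  apply is_lim_seq_spec in HL.
  (* The 1 bounds [E] by [Rabs L + 1]; the other entry leaves an error [eps / 2] after division by 1
     - Q >= 1 - q. *)
  set (e1 := Rmin 1 (eps * (1 - q) / 2)).
  assert (He1 : 0 < e1) by (apply Rmin_glb_lt; nra).
  destruct (HL (mkposreal e1 He1)) as [N1 HN1]; simpl in HN1.
  assert (Hq3 : 0 < (1 - q) ^ 3) by (apply pow_lt; lra).
  (* [W] dominates E * 2Q / (1 - Q)^3 for every admissible [r], so the correction term is at most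
     [W / INR b]. *)
  set (W := (Rabs L + 1) * (2 / (1 - q) ^ 3)).
  destruct (INR_unbounded (W / (eps / 2))) as [N2 HN2].
  exists (N1 + N2 + 1)%nat; intros t Ht r Hr Hqr.
  assert (Ht0 : (0 < t)%nat) by lia.
  set (b := (t * k2)%nat); set (d := (t * k1 - t * k2)%nat).
  assert (Hb0 : (0 < b)%nat) by (unfold b; nia).
  assert (EQ : profile r (INR d) (INR b) = qq r k1 k2)
    by (apply profile_qq; lra || lia).
  pose proof (Series_green_edge_bounds d r b Hr Hb0 ltac:(lra)) as B; cbv zeta in B; rewrite EQ in B.
  pose proof (base1_green_edge r k1 k2 t ltac:(lra) H12) as EB; fold d b in EB.
  specialize (HN1 t ltac:(lia)).
  set (E := sqrt (INR t) * scaled_binomial k1 k2 t) in *.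
  assert (HE1 : Rabs (E - L) < 1) by (eapply Rlt_le_trans; [exact HN1|apply Rmin_l]).
  assert (HE2 : Rabs (E - L) < eps * (1 - q) / 2) by (eapply Rlt_le_trans; [exact HN1|apply Rmin_r]).
  pose proof (profile_pos r (INR d) (INR b) ltac:(lra) (lt_0_INR b Hb0) (pos_INR d)) as PQ.
  rewrite EQ in PQ.
  set (Q := qq r k1 k2) in *.
  set (w := sqrt (INR t) * base1 r k1 k2 ^ t).
  set (T := Series (fun l => green d r (b + l))) in *.
  pose proof (green_pos d r b ltac:(lra)) as G0.
  assert (Ew : w * green d r b = E) by (unfold w, E; rewrite <- EB; ring).
  assert (Hw : 0 <= w).
  { unfold w; apply Rmult_le_pos; [apply sqrt_pos|apply pow_le].
    pose proof (kappa_pos k1 k2 ltac:(lia) H2).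
    replace (base1 r k1 k2) with (r ^ (k1 + k2) * kappa k1 k2)
      by (unfold base1, kappa, Rdiv; ring).
    apply Rmult_le_pos; [apply pow_le|]; lra. }
  assert (HE0 : 0 <= E) by (rewrite <- Ew; apply Rmult_le_pos; lra).
  unfold seq1; rewrite ct_green by assumption; fold d b T w.
  replace (lim1 r k1 k2) with (L / (1 - Q)) by (unfold lim1, L, Q, Rdiv; ring).
  rewrite <- RtoC_mult, <- RtoC_minus, Cmod_R.
  assert (U : w * T <= E / (1 - Q)).
  { rewrite <- Ew; unfold Rdiv; rewrite Rmult_assoc; apply Rmult_le_compat_l; [exact Hw|apply B]. }
  assert (V : E * (/ (1 - Q) - 2 * Q / ((1 - Q) ^ 3 * INR b)) <= w * T).
  { rewrite <- Ew, Rmult_assoc; apply Rmult_le_compat_l; [exact Hw|apply B]. }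
  assert (D1 : Rabs (E / (1 - Q) - L / (1 - Q)) < eps / 2).
  { replace (E / (1 - Q) - L / (1 - Q)) with ((E - L) * / (1 - Q)) by (field; lra).
    rewrite Rabs_mult, (Rabs_pos_eq (/ (1 - Q))) by (left; apply Rinv_0_lt_compat; lra).
    apply Rmult_lt_reg_r with (1 - Q); [lra|].
    rewrite Rmult_assoc, Rinv_l, Rmult_1_r by lra; nra. }
  assert (D2 : E * (2 * Q / ((1 - Q) ^ 3 * INR b)) < eps / 2).
  { assert (Ht' : W / (eps / 2) < INR b).
    { pose proof (le_INR N2 b ltac:(unfold b; nia)); lra. }
    pose proof (lt_0_INR b Hb0) as Pb.
    apply Rle_lt_trans with (W / INR b).
    - assert (Hc : (1 - q) ^ 3 <= (1 - Q) ^ 3) by (apply pow_incr; lra).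
      replace (2 * Q / ((1 - Q) ^ 3 * INR b)) with (2 * Q / (1 - Q) ^ 3 * / INR b)
        by (field; lra).
      unfold W; unfold Rdiv at 2; rewrite Rmult_assoc.
      assert (Hi : 0 <= / INR b) by (left; now apply Rinv_0_lt_compat).
      assert (H0 : 0 <= 2 * Q / (1 - Q) ^ 3) by (apply Rdiv_le_0_compat; lra).
      apply Rmult_le_compat; [exact HE0|now apply Rmult_le_pos| |].
      + apply Rabs_def2 in HE1; pose proof (Rle_abs L); lra.
      + apply Rmult_le_compat_r; [exact Hi|].
        apply Rmult_le_compat; [lra| |lra|apply Rinv_le_contravar; lra].
        left; apply Rinv_0_lt_compat; lra.
    - apply Rmult_lt_reg_r with (INR b / (eps / 2)); [apply Rdiv_lt_0_compat; lra|].
      replace (W / INR b * (INR b / (eps / 2))) with (W / (eps / 2)) by (field; lra).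
      replace (eps / 2 * (INR b / (eps / 2))) with (INR b) by (field; lra); exact Ht'. }
  rewrite Rmult_minus_distr_l in V; fold (E / (1 - Q)) in V.
  apply Rabs_def2 in D1; apply Rabs_def1; lra.
Qed.

(** * The balanced case (ii) *)

(* Parameters of the expansion of [profile r D (B + x)] around a point [B] where [profile r D B = 1]. *)
Definition drift (B D x : R) : R := x * (x + (2 * B + D)) / ((x + (B + D)) * (x + B)).
Definition spread (B D : R) : R := (2 * B + D) / ((B + D) * B).
Definition skew (B D : R) : R := D ^ 2 / (2 * B + D) ^ 2.

Lemma skew_bounds (B D : R) : 0 < B -> 0 < D -> 0 < skew B D <= 1.
Proof.
  intros HB HD; unfold skew; split.
  - apply Rdiv_lt_0_compat; apply pow_lt; lra.
  - apply Rmult_le_reg_r with ((2 * B + D) ^ 2); [apply pow_lt; lra|].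
    unfold Rdiv; rewrite Rmult_assoc, Rinv_l by (apply pow_nonzero; lra); nra.
Qed.

Lemma spread_pos (B D : R) : 0 < B -> 0 < D -> 0 < spread B D.
Proof. intros; apply Rdiv_lt_0_compat; nra. Qed.

(** The condition at [B] determines r^2 and eliminates it, leaving a rational function of [B], [D]
    and [x]. To first order in [x] the drift is [x * spread B D]. *)
Lemma profile_shift (r B D x : R) : 0 < r -> 0 < B -> 0 < D -> 0 < B + x ->
  profile r D B = 1 -> profile r D (B + x) = 1 - skew B D * drift B D x.
Proof.
  intros Hr HB HD Hx H; unfold profile, skew, drift in *.
  assert (Hr2 : 0 < r ^ 2) by (apply pow_lt; lra).
  assert (E : r ^ 2 = (2 * B + D) ^ 2 / (B * (B + D))).
  { apply Rmult_eq_reg_r with (/ r ^ 2); [|apply Rinv_neq_0_compat; lra].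
    rewrite Rinv_r by lra; rewrite <- H; field; repeat split; nra. }
  rewrite E; field; repeat split; nra.
Qed.

(** The crude linear bound serves the tail outside the window, the second-order bounds serve the
    pairing of mirrored terms. Both come from explicit formulas, the latter from the exact remainder
    [E]. *)
Lemma drift_right (B D x : R) : 0 < B -> 0 < D -> 0 <= x <= B ->
  x * spread B D / 4 <= drift B D x /\
  x * spread B D - 2 * spread B D ^ 2 * x ^ 2 <= drift B D x <= x * spread B D.
Proof.
  intros HB HD Hx.
  set (n := 2 * B + D); set (a := B + D).
  assert (Ha : 0 < a) by (unfold a; lra); assert (Hn : 0 < n) by (unfold n; lra).
  assert (HaB : 0 < a * B) by nra.
  assert (Hxx : 0 < (x + a) * (x + B)) by nra.
  assert (Hlow : a * B <= (x + a) * (x + B)) by nra.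
  assert (Hx2 : 0 <= x ^ 2) by (apply pow2_ge_0).
  assert (E : x * spread B D - drift B D x =
    x ^ 2 * (n ^ 2 + n * x - a * B) * / ((a * B) * ((x + a) * (x + B)))).
  { unfold spread, drift, n, a; field; repeat split; unfold a in *; nra. }
  assert (I0 : 0 < / ((a * B) * ((x + a) * (x + B))))
    by (apply Rinv_0_lt_compat, Rmult_lt_0_compat; assumption).
  assert (Hq : 0 <= n ^ 2 + n * x - a * B) by (unfold n, a; nra).
  repeat split.
  - unfold spread, drift; fold n a.
    replace (x * (n / (a * B)) / 4) with (x * n * / (4 * (a * B))) by (field; lra).
    unfold Rdiv; apply Rmult_le_compat; [nra|left; apply Rinv_0_lt_compat; lra|nra|].
    apply Rinv_le_contravar; [lra|].
    assert (x <= a) by (unfold a; lra); nra.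
  - assert (x * spread B D - drift B D x <= 2 * spread B D ^ 2 * x ^ 2); [|lra].
    rewrite E; unfold spread; fold n a.
    replace (2 * (n / (a * B)) ^ 2 * x ^ 2) with (x ^ 2 * (2 * n ^ 2) * / ((a * B) * (a * B)))
      by (field; lra).
    apply Rmult_le_compat; [nra|lra| |].
    + apply Rmult_le_compat_l; [lra|]; unfold n, a; nra.
    + apply Rinv_le_contravar; [nra|]; apply Rmult_le_compat_l; lra.
  - assert (0 <= x * spread B D - drift B D x); [|lra].
    rewrite E; apply Rmult_le_pos; [nra|lra].
Qed.

(** Staying within half of [B] keeps the denominator above a quarter of its central value, which is
    the origin of the constant 4. *)
Lemma drift_left (B D x : R) : 0 < B -> 0 < D -> 0 <= x <= B / 2 ->
  - x * spread B D - 4 * spread B D ^ 2 * x ^ 2 <= drift B D (- x) <= - x * spread B D.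
Proof.
  intros HB HD Hx.
  set (n := 2 * B + D); set (a := B + D).
  assert (Ha : B < a) by (unfold a; lra); assert (Hn : 0 < n) by (unfold n; lra).
  assert (HaB : 0 < a * B) by nra.
  assert (Hlow : a * B / 4 <= (- x + a) * (- x + B)).
  { replace (a * B / 4) with (a / 2 * (B / 2)) by field; apply Rmult_le_compat; lra. }
  assert (Hx2 : 0 <= x ^ 2) by (apply pow2_ge_0).
  assert (E : - x * spread B D - drift B D (- x) =
    x ^ 2 * (n ^ 2 - n * x - a * B) * / ((a * B) * ((- x + a) * (- x + B)))).
  { unfold spread, drift, n, a; field; repeat split; unfold a in *; nra. }
  assert (I0 : 0 < / ((a * B) * ((- x + a) * (- x + B))))
    by (apply Rinv_0_lt_compat, Rmult_lt_0_compat; lra).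
  assert (Hq : 0 <= n ^ 2 - n * x - a * B) by (unfold n, a; nra).
  split.
  - assert (- x * spread B D - drift B D (- x) <= 4 * spread B D ^ 2 * x ^ 2); [|lra].
    rewrite E; unfold spread; fold n a.
    replace (4 * (n / (a * B)) ^ 2 * x ^ 2) with (x ^ 2 * n ^ 2 * / ((a * B) * (a * B / 4)))
      by (field; lra).
    apply Rmult_le_compat; [nra|lra| |].
    + apply Rmult_le_compat_l; [lra|]; nra.
    + apply Rinv_le_contravar; [nra|]; apply Rmult_le_compat_l; lra.
  - assert (0 <= - x * spread B D - drift B D (- x)); [|lra].
    rewrite E; apply Rmult_le_pos; [nra|lra].
Qed.

(* [h1] and [h2] stand for the drifts at [j + 1] and [- j]: their linear parts cancel up to [y], which leaves
   an error quadratic in [y J]. *)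
Lemma near_one_product (k y J j h1 h2 z1 z2 : R) :
  0 < k <= 1 -> 0 < y -> 0 <= j -> j + 1 <= J -> j * y <= 1 ->
  5 * y + 20 * y ^ 2 * J ^ 2 <= 1 ->
  (j + 1) * y - 2 * y ^ 2 * (j + 1) ^ 2 <= h1 <= (j + 1) * y -> 0 <= h1 ->
  - j * y - 4 * y ^ 2 * j ^ 2 <= h2 <= - j * y ->
  0 <= z1 <= y -> 0 <= z2 <= y ->
  1 - (5 * y + 20 * y ^ 2 * J ^ 2) <= (1 - k * h1) * (1 - z1) * ((1 - k * h2) * (1 - z2)) <=
  1 + (5 * y + 20 * y ^ 2 * J ^ 2).
Proof.
  intros Hk Hy Hj HJ Hjy Hd H1 H10 H2 Hz1 Hz2.
  set (q := y ^ 2 * J ^ 2) in *.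
  replace (20 * y ^ 2 * J ^ 2) with (20 * q) in * by (unfold q; ring).
  assert (Q0 : 0 <= q) by (apply Rmult_le_pos; apply pow2_ge_0).
  assert (Hy2 : 0 <= y ^ 2) by (apply pow2_ge_0).
  assert (Q1 : y ^ 2 * (j + 1) ^ 2 <= q).
  { apply Rmult_le_compat_l; [lra|]; apply pow_incr; lra. }
  assert (Q2 : y ^ 2 * j ^ 2 <= q).
  { apply Rmult_le_compat_l; [lra|]; apply pow_incr; lra. }
  assert (S1 : h1 + h2 <= y) by lra.
  assert (S2 : y - 6 * q <= h1 + h2) by lra.
  assert (A2 : - 5 * (j * y) <= h2).
  { assert (y ^ 2 * j ^ 2 <= j * y) by (replace (y ^ 2 * j ^ 2) with ((j * y) * (j * y)) by ring;
      assert (0 <= j * y) by nra; nra).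
    lra. }
  assert (A3 : h2 <= 0) by nra.
  assert (S3 : - 5 * q <= h1 * h2).
  { assert (0 <= j * y) by nra.
    assert (h1 * (- h2) <= ((j + 1) * y) * (5 * (j * y))) by (apply Rmult_le_compat; lra).
    assert (((j + 1) * y) * (5 * (j * y)) <= 5 * q).
    { replace ((j + 1) * y * (5 * (j * y))) with (5 * (y ^ 2 * ((j + 1) * j))) by ring.
      assert (y ^ 2 * ((j + 1) * j) <= y ^ 2 * (j + 1) ^ 2) by (apply Rmult_le_compat_l; nra).
      lra. }
    lra. }
  assert (S4 : h1 * h2 <= 0) by nra.
  set (P := (1 - k * h1) * (1 - k * h2)).
  assert (EP : P = 1 - k * (h1 + h2) + k ^ 2 * (h1 * h2)) by (unfold P; ring).
  assert (K2 : 0 <= k ^ 2 <= 1) by nra.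
  assert (PL : 1 - y - 5 * q <= P).
  { assert (k * (h1 + h2) <= y) by nra.
    assert (- 5 * q <= k ^ 2 * (h1 * h2)) by nra. lra. }
  assert (PU : P <= 1 + 6 * q).
  { assert (- 6 * q <= k * (h1 + h2)) by nra.
    assert (k ^ 2 * (h1 * h2) <= 0) by nra. lra. }
  replace ((1 - k * h1) * (1 - z1) * ((1 - k * h2) * (1 - z2))) with (P * ((1 - z1) * (1 - z2)))
    by (unfold P; ring).
  assert (Z1 : 1 - 2 * y <= (1 - z1) * (1 - z2)) by nra.
  assert (Z2 : (1 - z1) * (1 - z2) <= 1) by nra.
  set (Z := (1 - z1) * (1 - z2)) in *.
  assert (0 <= P) by lra.
  split; nra.
Qed.

(** One step outwards multiplies the ratio of the mirrored terms v(b + j) and v(b - j) by [p * q],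
    which is within [delta] of 1. Starting from ratio 1 at the centre, j steps cost at most
    [j * delta] in either direction. *)
Lemma pair_bounds (v : nat -> R) (b J : nat) (delta : R) :
  (forall m, 0 < v m) -> (J <= b)%nat -> 0 <= delta -> INR J * delta <= 1 ->
  (forall j, (j < J)%nat -> exists p q, 0 < p /\ 0 < q /\ v (S (b + j)) = p * v (b + j)%nat /\
     v (b - j)%nat = q * v (b - S j)%nat /\ 1 - delta <= p * q <= 1 + delta) ->
  forall j, (j <= J)%nat ->
    (1 - INR j * delta) * v (b - j)%nat <= v (b + j)%nat /\
    (1 - INR j * delta) * v (b + j)%nat <= v (b - j)%nat.
Proof.
  intros Hv HJb Hd HJ Hs; induction j as [|j IH]; intros Hj.
  - simpl INR; rewrite Nat.sub_0_r, Nat.add_0_r; lra.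
  - destruct (IH ltac:(lia)) as [I1 I2]; destruct (Hs j ltac:(lia)) as (p & q & Hp & Hq & E1 & E2 & B).
    rewrite Nat.add_succ_r, S_INR.
    assert (X : INR j * delta <= 1 - delta).
    { pose proof (le_INR (S j) J Hj) as Q; rewrite S_INR in Q; nra. }
    assert (X0 : 0 <= INR j * delta) by (apply Rmult_le_pos; [apply pos_INR|exact Hd]).
    pose proof (Hv (b - S j)%nat) as V1; pose proof (Hv (b + j)%nat) as V2.
    set (x := INR j * delta) in *.
    replace ((INR j + 1) * delta) with (x + delta) by (unfold x; ring).
    rewrite E1; rewrite E2 in I1, I2.
    split.
    + apply Rle_trans with (p * ((1 - x) * (q * v (b - S j)%nat))).
      * replace (p * ((1 - x) * (q * v (b - S j)%nat))) with ((p * q) * (1 - x) * v (b - S j)%nat) by ring.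
        apply Rmult_le_compat_r; [lra|].
        apply Rle_trans with ((1 - delta) * (1 - x)); [nra|apply Rmult_le_compat_r; lra].
      * apply Rmult_le_compat_l; lra.
    + apply Rmult_le_reg_l with q; [exact Hq|].
      apply Rle_trans with ((1 - x) * v (b + j)%nat); [|exact I2].
      replace (q * ((1 - (x + delta)) * (p * v (b + j)%nat)))
        with ((p * q) * (1 - (x + delta)) * v (b + j)%nat) by ring.
      apply Rmult_le_compat_r; [lra|].
      apply Rle_trans with ((1 + delta) * (1 - (x + delta))); [apply Rmult_le_compat_r; lra|nra].
Qed.

Lemma psum_split (v : nat -> R) (b J : nat) : (J <= b)%nat ->
  psum v b = psum v (b - J) + psum (fun j => v (b - S j)%nat) J.
Proof.
  induction J as [|J IH]; intros H.
  - simpl; rewrite Nat.sub_0_r; ring.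
  - rewrite IH by lia; replace (b - J)%nat with (S (b - S J)) by lia; simpl; ring.
Qed.

Lemma psum_plus (u v : nat -> R) (n : nat) : psum (fun i => u i + v i) n = psum u n + psum v n.
Proof. induction n as [|n IH]; simpl; [ring|rewrite IH; ring]. Qed.

Lemma psum_scal (k : R) (u : nat -> R) (n : nat) : psum (fun i => k * u i) n = k * psum u n.
Proof. induction n as [|n IH]; simpl; [ring|rewrite IH; ring]. Qed.

Lemma inv_le_spread (B D x : R) : 0 < B -> 0 < D -> B <= x -> 0 < / x <= spread B D.
Proof.
  intros HB HD Hx; split; [apply Rinv_0_lt_compat; lra|].
  apply Rle_trans with (/ B); [apply Rinv_le_contravar; lra|].
  unfold spread; apply Rmult_le_reg_r with ((B + D) * B); [nra|].
  unfold Rdiv; rewrite (Rmult_assoc (2 * B + D)), Rinv_l by nra.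
  replace (/ B * ((B + D) * B)) with (B + D) by (field; lra); lra.
Qed.

Lemma green_edge_max (d b j : nat) (r : R) : 0 < r -> (0 < b)%nat ->
  profile r (INR d) (INR b) = 1 -> green d r (b + j) <= green d r b.
Proof.
  intros Hr Hb HP; induction j as [|j IH]; [rewrite Nat.add_0_r; lra|].
  rewrite Nat.add_succ_r.
  pose proof (green_le_ratio d r b (b + j) Hr ltac:(lia)) as H; rewrite HP in H; lra.
Qed.

(** * Near-symmetry around the peak within a window of half-width [J] *)

Section Balance.

Variables (r : R) (d b J : nat).
Hypotheses (Hr : 2 < r) (Hd : (0 < d)%nat) (HJ : (0 < J)%nat) (HJb : (2 * J <= b)%nat).
Hypothesis HP : profile r (INR d) (INR b) = 1.

Let k := skew (INR b) (INR d).
Let y := spread (INR b) (INR d).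
(** The error of one outward step, in the form delivered by [near_one_product]. Over the window it
    adds up to [INR J * delta], of order J y + J^3 y^2. *)
Let delta := 5 * y + 20 * y ^ 2 * INR J ^ 2.

Hypothesis Hdelta : INR J * delta <= / 2.

Lemma balance_basics : 0 < INR b /\ 0 < INR d /\ 1 <= INR J /\ INR J <= INR b / 2 /\
  0 < k <= 1 /\ 0 < y /\ delta <= / 2 /\ INR J * y <= / 10.
Proof.
  assert (B0 : 0 < INR b) by (apply lt_0_INR; lia).
  assert (D0 : 0 < INR d) by (apply lt_0_INR; lia).
  assert (J1 : 1 <= INR J) by (apply (le_INR 1); lia).
  assert (JB : INR J <= INR b / 2).
  { pose proof (le_INR _ _ HJb) as H; rewrite mult_INR in H; simpl (INR 2) in H; lra. }
  pose proof (skew_bounds _ _ B0 D0) as K; pose proof (spread_pos _ _ B0 D0) as Y.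
  fold k in K; fold y in Y.
  assert (0 <= y ^ 2 * INR J ^ 2) by (apply Rmult_le_pos; apply pow2_ge_0).
  assert (0 < delta) by (unfold delta; lra).
  repeat split; try lra.
  - nra.
  - assert (INR J * (5 * y) <= INR J * delta) by (apply Rmult_le_compat_l; unfold delta; lra); lra.
Qed.

Lemma green_pair (j : nat) : (j <= J)%nat ->
  (1 - INR j * delta) * green d r (b - j) <= green d r (b + j) /\
  (1 - INR j * delta) * green d r (b + j) <= green d r (b - j).
Proof.
  destruct balance_basics as (B0 & D0 & J1 & JB & K & Y & D1 & JY).
  assert (0 <= y ^ 2 * INR J ^ 2) by (apply Rmult_le_pos; apply pow2_ge_0).
  revert j; apply pair_bounds; [intros; apply green_pos; lra|lia|unfold delta; lra|lra|].
  intros j Hj.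
  assert (Pj : 0 <= INR j) by apply pos_INR.
  assert (PjJ : INR j + 1 <= INR J) by (rewrite <- S_INR; now apply le_INR).
  set (z1 := / (2 * INR (S (b + j)) + INR d)); set (z2 := / (2 * INR (b - j) + INR d)).
  assert (E1 : INR (S (b + j)) = INR b + (INR j + 1)) by (rewrite S_INR, plus_INR; ring).
  assert (E2 : INR (b - j) = INR b + - INR j) by (rewrite minus_INR by lia; ring).
  assert (Z1 : 0 < z1 <= y) by (apply inv_le_spread; lra).
  assert (Z2 : 0 < z2 <= y) by (apply inv_le_spread; lra).
  assert (Y1 : y <= / 10) by nra.
  pose proof (profile_pos r (INR d) (INR (S (b + j))) ltac:(lra) ltac:(lra) ltac:(lra)) as P1.
  pose proof (profile_pos r (INR d) (INR (b - j)) ltac:(lra) ltac:(lra) ltac:(lra)) as P2.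
  exists (profile r (INR d) (INR (S (b + j))) * (1 - z1)),
         (profile r (INR d) (INR (b - j)) * (1 - z2)).
  split; [apply Rmult_lt_0_compat; lra|]; split; [apply Rmult_lt_0_compat; lra|].
  split; [apply green_ratio; lra|]; split.
  - pose proof (green_ratio d r (b - S j) ltac:(lra)) as G.
    replace (S (b - S j)) with (b - j)%nat in G by lia; exact G.
  - rewrite E1, E2, !profile_shift by (assumption || lra); fold k.
    apply (near_one_product k y (INR J) (INR j)); try lra; try assumption.
    + nra.
    + fold delta; lra.
    + pose proof (drift_right (INR b) (INR d) (INR j + 1) B0 D0 ltac:(lra)) as [_ Q].
      exact Q.
    + pose proof (drift_right (INR b) (INR d) (INR j + 1) B0 D0 ltac:(lra)) as [Q _].
      fold y in Q; assert (0 <= (INR j + 1) * y) by nra; lra.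
    + pose proof (drift_left (INR b) (INR d) (INR j) B0 D0 ltac:(lra)) as Q; exact Q.
Qed.

(** Beyond the window the ratio is at most 1 - k J y / 4, by the crude drift bound, and the terms
    stay below the edge term, so a geometric series dominates. *)
Lemma green_upper_tail :
  Series (fun l => green d r (S b + (J + l))) <= 4 * green d r b / (k * INR J * y).
Proof.
  destruct balance_basics as (B0 & D0 & J1 & JB & K & Y & D1 & JY).
  set (s := profile r (INR d) (INR (b + J))).
  assert (Es : s = 1 - k * drift (INR b) (INR d) (INR J)).
  { unfold s; rewrite plus_INR; apply profile_shift; assumption || lra. }
  destruct (drift_right (INR b) (INR d) (INR J) B0 D0 ltac:(lra)) as [Q _]; fold y in Q.
  assert (Hky : 0 < k * INR J * y) by (apply Rmult_lt_0_compat; nra).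
  assert (Hs : k * INR J * y / 4 <= 1 - s) by (rewrite Es; nra).
  assert (Hs0 : 0 < s).
  { apply profile_pos; [lra| |lra]; apply lt_0_INR; lia. }
  eapply Rle_trans.
  - apply (Series_le_geom _ s); [lra|intros; left; apply green_pos; lra|].
    intros l; rewrite !Nat.add_succ_r; apply green_le_ratio; [lra|lia].
  - replace (4 * green d r b / (k * INR J * y)) with (green d r b / (k * INR J * y / 4))
      by (field; repeat split; lra).
    unfold Rdiv at 1 2; apply Rmult_le_compat.
    + left; apply green_pos; lra.
    + left; apply Rinv_0_lt_compat; lra.
    + replace (S b + (J + 0))%nat with (b + S J)%nat by lia.
      apply green_edge_max; assumption || lra || lia.
    + apply Rinv_le_contravar; lra.
Qed.

(** Below the window the profile is at least 1 + Z with Z = k J y. The second hypothesis says 1/d <=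
    Z/4, and with Z <= 1 the growth factor (1 + Z)(1 - Z/4) is still at least 1 + Z/2. The last term
    b - J is compared with its mirror image, hence is at most twice the edge term. *)
Lemma green_lower_tail : k * INR J * y <= 1 -> 4 <= k * INR J * y * INR d ->
  psum (green d r) (b - J) <= 4 * green d r b / (k * INR J * y).
Proof.
  intros H1 H4.
  destruct balance_basics as (B0 & D0 & J1 & JB & K & Y & D1 & JY).
  set (Z := k * INR J * y) in *.
  assert (HZ : 0 < Z) by (apply Rmult_lt_0_compat; nra).
  set (s := profile r (INR d) (INR (b - J)) * (1 - / INR d)).
  assert (Es : profile r (INR d) (INR (b - J)) = 1 - k * drift (INR b) (INR d) (- INR J)).
  { rewrite minus_INR by lia; apply profile_shift; assumption || lra. }
  destruct (drift_left (INR b) (INR d) (INR J) B0 D0 ltac:(lra)) as [_ Q]; fold y in Q.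
  assert (P1 : 1 + Z <= profile r (INR d) (INR (b - J))) by (rewrite Es; unfold Z; nra).
  assert (Hi : / INR d <= Z / 4).
  { apply Rmult_le_reg_r with (INR d); [lra|]; rewrite Rinv_l by lra; lra. }
  assert (Hs : 1 + Z / 2 <= s).
  { apply Rle_trans with ((1 + Z) * (1 - Z / 4)); [nra|].
    unfold s; apply Rmult_le_compat; lra. }
  eapply Rle_trans.
  - apply (psum_le_geom (green d r) s (b - J)); [lra|left; apply green_pos; lra|].
    intros m Hm; apply green_ge_ratio; lra || lia.
  - replace (4 * green d r b / Z) with ((2 * green d r b) / (Z / 2)) by (field; lra).
    unfold Rdiv at 1 2; apply Rmult_le_compat.
    + left; apply green_pos; lra.
    + left; apply Rinv_0_lt_compat; lra.
    + destruct (green_pair J ltac:(lia)) as [G _].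
      pose proof (green_edge_max d b J r ltac:(lra) ltac:(lia) HP).
      pose proof (green_pos d r (b - J) ltac:(lra)); nra.
    + apply Rinv_le_contravar; lra.
Qed.

(** The term at [b] belongs to neither side. Inside the window, terms at equal distance from [b] are
    paired and cost a fraction [INR J * delta] of the total mass; the two outer tails contribute 4
    each to the constant 8. *)
Lemma green_balance : k * INR J * y <= 1 -> 4 <= k * INR J * y * INR d ->
  Rabs (Series (fun l => green d r (S b + l)) - psum (green d r) b) <=
  8 * green d r b / (k * INR J * y) + INR J * delta * Series (green d r).
Proof.
  intros H1 H4.
  destruct balance_basics as (B0 & D0 & J1 & JB & K & Y & D1 & JY).
  pose proof (green_lower_tail H1 H4) as TL; pose proof green_upper_tail as TU.
  pose proof (ex_series_green d r Hr) as Ex.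
  assert (Gp : forall m, 0 <= green d r m) by (intros; left; apply green_pos; lra).
  destruct (Series_psum (green d r) (S b) Ex) as [ExU EU].
  destruct (Series_psum (fun l => green d r (S b + l)) J ExU) as [ExV EV].
  set (U := psum (fun l => green d r (S b + l)) J) in *.
  set (V := Series (fun l => green d r (S b + (J + l)))) in *.
  rewrite (psum_split (green d r) b J) by lia.
  set (L := psum (fun j => green d r (b - S j)) J) in *.
  set (W := psum (green d r) (b - J)) in *.
  assert (V0 : 0 <= V).
  { unfold V; rewrite <- (Rmult_0_l (Series (fun l => green d r (S b + (J + l))))), <- Series_scal_l.
    apply Series_le; [|exact ExV]; intros l; pose proof (Gp (S b + (J + l))%nat); lra. }
  assert (W0 : 0 <= W) by (apply psum_nonneg; exact Gp).
  assert (UL : U + L <= Series (green d r)).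
  { rewrite EU, EV; fold U V; cbn [psum]; rewrite (psum_split (green d r) b J) by lia.
    fold L W; pose proof (Gp b); lra. }
  assert (D0' : 0 <= delta).
  { assert (0 <= y ^ 2 * INR J ^ 2) by (apply Rmult_le_pos; apply pow2_ge_0).
    unfold delta; lra. }
  assert (Pt : forall j, (j < J)%nat ->
    green d r (S b + j) - green d r (b - S j) <= INR J * delta * (green d r (S b + j) + green d r (b - S j)) /\
    green d r (b - S j) - green d r (S b + j) <= INR J * delta * (green d r (S b + j) + green d r (b - S j))).
  { intros j Hj; destruct (green_pair (S j) ltac:(lia)) as [G1 G2].
    replace (S b + j)%nat with (b + S j)%nat by lia.
    pose proof (Gp (b + S j)%nat); pose proof (Gp (b - S j)%nat).
    assert (INR (S j) * delta <= INR J * delta)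
      by (apply Rmult_le_compat_r; [exact D0'|apply le_INR; lia]).
    set (x := INR (S j) * delta) in *; set (X := INR J * delta) in *.
    assert (x * green d r (b - S j) <= X * green d r (b - S j)) by (now apply Rmult_le_compat_r).
    assert (x * green d r (b + S j) <= X * green d r (b + S j)) by (now apply Rmult_le_compat_r).
    assert (0 <= X) by (apply Rmult_le_pos; lra).
    assert (0 <= X * green d r (b - S j)) by (now apply Rmult_le_pos).
    assert (0 <= X * green d r (b + S j)) by (now apply Rmult_le_pos).
    split; lra. }
  set (X := INR J * delta) in *.
  assert (A1 : U - L <= X * (U + L)).
  { unfold U, L; rewrite <- psum_plus, <- psum_scal.
    enough (psum (fun l => green d r (S b + l)) J <=
      psum (fun i => X * (green d r (S b + i) + green d r (b - S i)) + green d r (b - S i)) J) as Q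
      by (rewrite psum_plus in Q; lra).
    apply psum_le; intros j Hj; pose proof (Pt j Hj); lra. }
  assert (A2 : L - U <= X * (U + L)).
  { unfold U, L; rewrite <- psum_plus, <- psum_scal.
    enough (psum (fun l => green d r (b - S l)) J <=
      psum (fun i => X * (green d r (S b + i) + green d r (b - S i)) + green d r (S b + i)) J) as Q
      by (rewrite psum_plus in Q; lra).
    apply psum_le; intros j Hj; pose proof (Pt j Hj); lra. }
  assert (X0 : 0 <= X) by (apply Rmult_le_pos; lra).
  assert (X * (U + L) <= X * Series (green d r)) by (now apply Rmult_le_compat_l).
  rewrite EV; fold U V.
  replace (8 * green d r b / (k * INR J * y)) with (2 * (4 * green d r b / (k * INR J * y)))
    by (field; repeat split; lra).
  apply Rabs_le; split; lra.
Qed.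

End Balance.

(** * Compact parameter sets and conclusion *)

Lemma qq_diag_lt_1 (r : R) (k : nat) : 2 < r -> (0 < k)%nat -> qq r k k < 1.
Proof.
  intros Hr H; pose proof (lt_0_INR k H).
  replace (qq r k k) with ((2 / r) ^ 2) by (unfold qq; field; split; lra).
  apply sq_ratio_lt_1; lra.
Qed.

Lemma seq23_critical (k1 k2 : nat) (r : R) : (k2 <= k1)%nat -> (0 < k2)%nat -> 2 < r ->
  qq r k1 k2 = 1 ->
  forall eps, 0 < eps -> exists N, forall t, (N <= t)%nat ->
    Cmod (seq23 r k1 k2 t - RtoC (lim2 r))%C < eps.
Proof.
  intros H12 H2 Hr Hq eps He.
  assert (Hk : (k2 < k1)%nat).
  { destruct (Nat.eq_dec k1 k2) as [->|]; [|lia]; pose proof (qq_diag_lt_1 r k2 Hr H2); lra. }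
  destruct (scaled_binomial_le k1 k2) as (M & HM & HB); try lia.
  pose proof (rho_bounds r Hr) as Hrho.
  set (m := INR (k1 - k2)).
  assert (Pm : 1 <= m) by (apply (le_INR 1); lia).
  assert (Pk : 1 <= INR k2) by (apply (le_INR 1); lia).
  (* [skew] is homogeneous of degree 0 and [spread] of degree -1, so at scale [t] they equal [kap]
     and [y0 / t]. *)
  set (kap := skew (INR k2) m); set (y0 := spread (INR k2) m).
  assert (Hkap : 0 < kap <= 1) by (apply skew_bounds; lra).
  assert (Hy0 : 0 < y0) by (apply spread_pos; lra).
  (* Chosen so that the contribution of the outer tails, 4M / (kap y0 A), is at most [eps / 4],
     independently of [t]. *)
  set (A := 1 + 16 * M / (kap * y0 * eps)).
  assert (HA : 1 <= A).
  { assert (0 < 16 * M / (kap * y0 * eps)); [|unfold A; lra].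
    apply Rdiv_lt_0_compat; [lra|].
    apply Rmult_lt_0_compat; [apply Rmult_lt_0_compat|]; lra. }
  assert (L3 : 0 < lim3 r).
  { unfold lim3; apply Rinv_0_lt_compat, sqrt_lt_R0.
    pose proof (sq_ratio_lt_1 r Hr) as Q.
    replace (4 / r ^ 2) with ((2 / r) ^ 2) by (field; lra); lra. }
  (* With J <= 2 A sqrt t and spread y0 / t, the accumulated pair error [INR J * delta] is at most
     [Dd / sqrt t]. *)
  set (Dd := 10 * A * y0 + 160 * y0 ^ 2 * A ^ 3).
  assert (HA3 : 1 <= A ^ 3) by (apply pow_R1_Rle; lra).
  assert (HDd : 0 < Dd).
  { unfold Dd; assert (0 < A * y0) by (apply Rmult_lt_0_compat; lra).
    assert (0 < y0 ^ 2 * A ^ 3) by (apply Rmult_lt_0_compat; [apply pow_lt|]; lra); lra. }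
  (* The sum of all positive quantities that must become small after division by sqrt t, so that one
     threshold serves them all. *)
  set (Ms := M + Dd * lim3 r + Dd + 2 * A * y0 + 4 * A + 4 / (kap * y0)).
  assert (Hky0 : 0 < kap * y0) by (now apply Rmult_lt_0_compat).
  assert (H4k : 0 < 4 / (kap * y0)) by (apply Rdiv_lt_0_compat; lra).
  assert (HDl : 0 < Dd * lim3 r) by (now apply Rmult_lt_0_compat).
  assert (HAy : 0 < A * y0) by nra.
  destruct (inv_sqrt_small Ms (Rmin (eps / 4) (/ 2))) as (N & HN0 & HN).
  { unfold Ms; lra. }
  { apply Rmin_glb_lt; lra. }
  exists N; intros t Ht; specialize (HN t Ht).
  assert (Ht0 : (0 < t)%nat) by lia.
  pose proof (lt_0_INR t Ht0) as Pt.
  set (u := sqrt (INR t)) in *.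
  assert (Hu : 0 < u) by (now apply sqrt_lt_R0).
  assert (Eu : INR t = u ^ 2) by (unfold u; rewrite pow2_sqrt; lra).
  assert (Small : forall x, x <= Ms -> x / u < eps / 4 /\ x / u < / 2).
  { intros x Hx.
    assert (x / u <= Ms / u) by (apply Rmult_le_compat_r; [left; now apply Rinv_0_lt_compat|exact Hx]).
    pose proof (Rmin_l (eps / 4) (/ 2)); pose proof (Rmin_r (eps / 4) (/ 2)); lra. }
  assert (SmallU : forall x, x <= Ms -> x < u / 2).
  { intros x Hx; destruct (Small x Hx) as [_ Q].
    apply Rmult_lt_compat_r with (r := u) in Q; [|exact Hu].
    unfold Rdiv in Q; rewrite Rmult_assoc, Rinv_l in Q; lra. }
  assert (U1 : 4 * A < u / 2) by (apply SmallU; unfold Ms; lra).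
  assert (U2 : 4 / (kap * y0) < u / 2) by (apply SmallU; unfold Ms; lra).
  assert (U3 : 2 * A * y0 < u / 2) by (apply SmallU; unfold Ms; lra).
  destruct (nfloor_ex (A * u)) as [j Hj]; [nra|].
  set (J := S j).
  assert (HJ : A * u <= INR J <= 2 * (A * u)) by (unfold J; rewrite S_INR; nra).
  set (b := (t * k2)%nat); set (d := (t * k1 - t * k2)%nat).
  assert (Eb : INR b = u ^ 2 * INR k2) by (unfold b; rewrite mult_INR, Eu; reflexivity).
  assert (Ed : INR d = u ^ 2 * m).
  { unfold d, m; rewrite <- Nat.mul_sub_distr_l, mult_INR, Eu; reflexivity. }
  assert (Hu2 : 0 < u ^ 2) by (apply pow_lt; lra).
  assert (Ek : skew (INR b) (INR d) = kap).
  { unfold kap, skew; rewrite Eb, Ed; field; repeat split; try lra.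
    replace (2 * (u ^ 2 * INR k2) + u ^ 2 * m) with (u ^ 2 * (2 * INR k2 + m)) by ring; nra. }
  assert (Ey : spread (INR b) (INR d) = y0 / u ^ 2).
  { unfold y0, spread; rewrite Eb, Ed; field; repeat split; try lra.
    replace (u ^ 2 * INR k2 + u ^ 2 * m) with (u ^ 2 * (INR k2 + m)) by ring; nra. }
  assert (HJb : (2 * J <= b)%nat).
  { apply INR_le; rewrite mult_INR, Eb; simpl (INR 2); nra. }
  assert (HPb : profile r (INR d) (INR b) = 1) by (rewrite <- Hq; apply profile_qq; lra || lia).
  assert (Hdelta : INR J * (5 * (y0 / u ^ 2) + 20 * (y0 / u ^ 2) ^ 2 * INR J ^ 2) <= Dd / u).
  { apply Rle_trans with
      (2 * (A * u) * (5 * (y0 / u ^ 2) + 20 * (y0 / u ^ 2) ^ 2 * (2 * (A * u)) ^ 2)).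
    - assert (0 < y0 / u ^ 2) by (now apply Rdiv_lt_0_compat).
      assert (0 <= 20 * (y0 / u ^ 2) ^ 2) by (assert (0 <= (y0 / u ^ 2) ^ 2) by apply pow2_ge_0; lra).
      apply Rmult_le_compat; [apply pos_INR| |lra|].
      + apply Rplus_le_le_0_compat; [lra|apply Rmult_le_pos; [lra|apply pow2_ge_0]].
      + apply Rplus_le_compat_l, Rmult_le_compat_l; [lra|].
        apply pow_incr; split; [apply pos_INR|lra].
    - right; unfold Dd; field; lra. }
  assert (HDu : Dd / u < / 2) by (apply Small; unfold Ms; lra).
  assert (HZ1 : kap * INR J * (y0 / u ^ 2) <= 1).
  { apply Rle_trans with (1 * (2 * (A * u)) * (y0 / u ^ 2)).
    - apply Rmult_le_compat_r; [left; now apply Rdiv_lt_0_compat|].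
      apply Rmult_le_compat; lra || apply pos_INR.
    - replace (1 * (2 * (A * u)) * (y0 / u ^ 2)) with ((2 * A * y0) / u) by (field; lra).
      left; apply Rlt_trans with (/ 2); [|lra]; apply Small; unfold Ms; lra. }
  assert (HZ2 : 4 <= kap * INR J * (y0 / u ^ 2) * INR d).
  { rewrite Ed.
    replace (kap * INR J * (y0 / u ^ 2) * (u ^ 2 * m)) with (kap * y0 * INR J * m) by (field; lra).
    assert (4 <= kap * y0 * u).
    { apply Rmult_lt_compat_l with (r := kap * y0) in U2; [|exact Hky0].
      replace (kap * y0 * (4 / (kap * y0))) with 4 in U2 by (field; lra); nra. }
    assert (kap * y0 * u <= kap * y0 * INR J) by (apply Rmult_le_compat_l; nra).
    assert (kap * y0 * INR J * 1 <= kap * y0 * INR J * m) by (apply Rmult_le_compat_l; lra).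
    lra. }
  pose proof (green_balance r d b J Hr ltac:(unfold d; nia) ltac:(unfold J; lia) HJb HPb) as Bal.
  rewrite Ek, Ey in Bal; specialize (Bal ltac:(lra) HZ1 HZ2).
  destruct (Series_psum (green d r) (S b) (ex_series_green d r Hr)) as [_ ES].
  set (V := Series (fun l => green d r (S b + l))) in *; cbn [psum] in ES.
  set (w := rho r ^ (t * (k1 - k2))).
  assert (Ew : Series (green d r) = w * lim3 r).
  { rewrite Series_green by assumption; unfold w, d; now rewrite <- Nat.mul_sub_distr_l. }
  assert (Hw : 0 < w) by (apply pow_lt; lra).
  pose proof (green_edge_le r k1 k2 t Hr H12 H2) as GE; fold d b w in GE.
  assert (GM : green d r b / w <= M / u) by (eapply Rle_trans; [exact GE|now apply HB]).
  assert (G0 : 0 < green d r b) by (apply green_pos; lra).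
  rewrite seq23_green, <- RtoC_minus, Cmod_R by assumption; fold d b w.
  replace (lim2 r) with (lim3 r / 2).
  2:{ unfold lim2, lim3; field.
      unfold lim3 in L3; intros Z; rewrite Z, Rinv_0 in L3; lra. }
  set (L := psum (green d r) b) in *.
  (* Since L + green d r b + V = w * lim3 r, the deviation from one half consists of half the edge
     term and half the imbalance of the two sides, normalised by [w]. *)
  replace (lim3 r - L / w - lim3 r / 2) with (green d r b / w / 2 + (V - L) / w / 2).
  2:{ rewrite Ew in ES; replace (lim3 r) with ((L + green d r b + V) / w)
        by (rewrite <- ES; field; lra); field; lra. }
  eapply Rle_lt_trans; [apply Rabs_triang|].
  rewrite (Rabs_pos_eq (green d r b / w / 2)).
  2:{ apply Rdiv_le_0_compat; [left; now apply Rdiv_lt_0_compat|lra]. }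
  assert (B1 : Rabs ((V - L) / w / 2) <= green d r b / w * (4 * u ^ 2 / (kap * INR J * y0)) + Dd / u * lim3 r).
  { replace ((V - L) / w / 2) with ((V - L) * / (2 * w)) by (field; lra).
    assert (Hi : 0 < / (2 * w)) by (apply Rinv_0_lt_compat; lra).
    rewrite Rabs_mult, (Rabs_pos_eq (/ (2 * w))) by lra.
    assert (PJ : 0 < INR J) by (apply lt_0_INR; unfold J; lia).
    apply Rle_trans with ((8 * green d r b / (kap * INR J * (y0 / u ^ 2)) + Dd / u * (w * lim3 r)) * / (2 * w)).
    - apply Rmult_le_compat_r; [lra|]; eapply Rle_trans; [exact Bal|].
      apply Rplus_le_compat_l; rewrite Ew; apply Rmult_le_compat_r; [nra|exact Hdelta].
    - assert (0 < Dd / u * lim3 r).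
      { apply Rmult_lt_0_compat; [now apply Rdiv_lt_0_compat|exact L3]. }
      replace ((8 * green d r b / (kap * INR J * (y0 / u ^ 2)) + Dd / u * (w * lim3 r)) * / (2 * w))
        with (green d r b / w * (4 * u ^ 2 / (kap * INR J * y0)) + (Dd / u * lim3 r) / 2)
        by (field; repeat split; lra).
      lra. }
  assert (B2 : green d r b / w * (4 * u ^ 2 / (kap * INR J * y0)) <= eps / 4).
  { apply Rle_trans with (M / u * (4 * u ^ 2 / (kap * (A * u) * y0))).
    - assert (HAu : 0 < A * u) by (apply Rmult_lt_0_compat; lra).
      assert (0 < kap * (A * u) * y0) by (apply Rmult_lt_0_compat; [apply Rmult_lt_0_compat|]; lra).
      apply Rmult_le_compat; [left; now apply Rdiv_lt_0_compat| |exact GM|].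
      + apply Rdiv_le_0_compat; [lra|].
        apply Rmult_lt_0_compat; [apply Rmult_lt_0_compat|]; lra.
      + apply Rmult_le_compat_l; [lra|]; apply Rinv_le_contravar; [lra|].
        apply Rmult_le_compat_r; [lra|]; apply Rmult_le_compat_l; lra.
    - replace (M / u * (4 * u ^ 2 / (kap * (A * u) * y0))) with (4 * M / (kap * y0) * / A)
        by (field; repeat split; lra).
      apply Rmult_le_reg_r with A; [lra|]; rewrite Rmult_assoc, Rinv_l, Rmult_1_r by lra.
      replace (4 * M / (kap * y0)) with (eps / 4 * (16 * M / (kap * y0 * eps)))
        by (field; repeat split; lra).
      apply Rmult_le_compat_l; unfold A; lra. }
  assert (B3 : M / u < eps / 4) by (apply Small; unfold Ms; lra).
  assert (B4 : Dd / u * lim3 r < eps / 4).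
  { replace (Dd / u * lim3 r) with (Dd * lim3 r / u) by (field; lra).
    apply Small; unfold Ms; lra. }
  assert (0 < M / u) by (now apply Rdiv_lt_0_compat).
  lra.
Qed.

Lemma filterlim_C_of_Cmod (s : nat -> C) (l : C) :
  (forall eps, 0 < eps -> exists N, forall t, (N <= t)%nat -> Cmod (s t - l)%C < eps) ->
  filterlim s eventually (locally l).
Proof.
  intros H; apply filterlim_locally; intros eps.
  destruct (H eps (cond_pos eps)) as [N HN].
  exists N; intros t Ht; apply ball_C_of_Cmod; auto.
Qed.

(** A compact set is closed, so its complement contains an interval around [x]. Applied at the
    critical [r] where [qq = 1], this turns the strict inequality on [K] into a uniform gap. *)
Lemma compact_avoids (K : R -> Prop) (x : R) : compact K -> ~ K x ->
  exists delta, 0 < delta /\ forall y, K y -> delta <= Rabs (y - x).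
Proof.
  intros HK Hx; apply compact_P2 in HK.
  destruct (HK x Hx) as [delta Hd].
  exists delta; split; [apply cond_pos|]; intros y Ky.
  destruct (Rle_lt_dec delta (Rabs (y - x))) as [Hle|Hlt]; [exact Hle|].
  exfalso; exact (Hd y Hlt Ky).
Qed.

Lemma qq_critical (k1 k2 : nat) : (0 < k1)%nat -> (0 < k2)%nat ->
  exists r0, 0 < r0 /\ forall r, 0 < r -> qq r k1 k2 = (r0 / r) ^ 2.
Proof.
  intros H1 H2; pose proof (lt_0_INR k1 H1); pose proof (lt_0_INR k2 H2).
  assert (P : 0 < INR k1 * INR k2) by nra.
  pose proof (sqrt_lt_R0 _ P).
  exists ((INR k1 + INR k2) / sqrt (INR k1 * INR k2)); split.
  - apply Rdiv_lt_0_compat; lra.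
  - intros r Hr; unfold qq.
    transitivity ((INR k1 + INR k2) ^ 2 / (r ^ 2 * sqrt (INR k1 * INR k2) ^ 2)).
    + rewrite pow2_sqrt by lra; field; repeat split; lra.
    + field; split; lra.
Qed.

Lemma qq_compact (k1 k2 : nat) (K : R -> Prop) : (0 < k1)%nat -> (0 < k2)%nat -> compact K ->
  (forall r, K r -> 2 < r /\ qq r k1 k2 < 1) ->
  exists q, q < 1 /\ forall r, K r -> qq r k1 k2 <= q.
Proof.
  intros H1 H2 HK HR; destruct (qq_critical k1 k2 H1 H2) as (r0 & P0 & E).
  destruct (compact_avoids K r0 HK) as (delta & Hd & D).
  { intros Kr; destruct (HR _ Kr) as [_ Q]; rewrite E in Q by lra.
    unfold Rdiv in Q; rewrite Rinv_r in Q by lra; lra. }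
  exists ((r0 / (r0 + delta)) ^ 2).
  assert (Hb : 0 < r0 / (r0 + delta) < 1).
  { split; [apply Rdiv_lt_0_compat; lra|].
    apply Rmult_lt_reg_r with (r0 + delta); [lra|]; field_simplify; lra. }
  split; [nra|]; intros r Kr; destruct (HR r Kr) as [Hr Q]; specialize (D r Kr).
  rewrite E in * by lra.
  assert (Hr0 : r0 < r).
  { destruct (Rlt_le_dec r0 r) as [|Hle]; [assumption|exfalso].
    assert (1 <= r0 / r) by (apply Rmult_le_reg_r with r; [lra|]; field_simplify; lra).
    nra. }
  rewrite Rabs_pos_eq in D by lra.
  apply pow_incr; split; [left; apply Rdiv_lt_0_compat; lra|].
  apply Rmult_le_compat_l; [lra|]; apply Rinv_le_contravar; lra.
Qed.

Lemma qq_compact_gt (k1 k2 : nat) (K : R -> Prop) : (0 < k1)%nat -> (0 < k2)%nat -> compact K ->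
  (forall r, K r -> 2 < r /\ 1 < qq r k1 k2) ->
  exists q, 1 < q /\ forall r, K r -> q <= qq r k1 k2.
Proof.
  intros H1 H2 HK HR; destruct (qq_critical k1 k2 H1 H2) as (r0 & P0 & E).
  destruct (compact_avoids K r0 HK) as (delta & Hd & D).
  { intros Kr; destruct (HR _ Kr) as [_ Q]; rewrite E in Q by lra.
    unfold Rdiv in Q; rewrite Rinv_r in Q by lra; lra. }
  (* On [K] one has r <= r0 - delta, and r0 / (r0 - delta) >= 1 + delta / r0. The weaker bound makes
     sense even when [K] is empty and [delta] exceeds [r0]. *)
  exists ((1 + delta / r0) ^ 2).
  assert (Hb : 0 < delta / r0) by (apply Rdiv_lt_0_compat; lra).
  split; [nra|]; intros r Kr; destruct (HR r Kr) as [Hr Q]; specialize (D r Kr).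
  rewrite E in * by lra.
  assert (Hr0 : r < r0).
  { destruct (Rlt_le_dec r r0) as [|Hle]; [assumption|exfalso].
    assert (r0 / r <= 1) by (apply Rmult_le_reg_r with r; [lra|]; field_simplify; lra).
    assert (0 < r0 / r) by (apply Rdiv_lt_0_compat; lra).
    nra. }
  rewrite Rabs_left in D by lra.
  apply pow_incr; split; [lra|].
  apply Rmult_le_reg_r with r; [lra|].
  replace (r0 / r * r) with r0 by (field; lra).
  assert (delta / r0 * r <= delta).
  { apply Rle_trans with (delta / r0 * r0); [apply Rmult_le_compat_l; lra|right; field; lra]. }
  lra.
Qed.

Theorem theorem4 (k1 k2 : nat) :
  (k2 <= k1)%nat -> (0 < k2)%nat ->
  (* (i) *)
  (forall r : R, 2 < r -> qq r k1 k2 < 1 ->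
     filterlim (seq1 r k1 k2) eventually (locally (RtoC (lim1 r k1 k2)))) /\
  (* (ii) *)
  (forall r : R, 2 < r -> qq r k1 k2 = 1 ->
     filterlim (seq23 r k1 k2) eventually (locally (RtoC (lim2 r)))) /\
  (* (iii) *)
  (forall r : R, 2 < r -> 1 < qq r k1 k2 ->
     filterlim (seq23 r k1 k2) eventually (locally (RtoC (lim3 r)))) /\
  (* uniformity in (i) on compact subsets of the region *)
  (forall K : R -> Prop, compact K ->
     (forall r, K r -> 2 < r /\ qq r k1 k2 < 1) ->
     unif_cvg_on K (fun r t => seq1 r k1 k2 t) (fun r => RtoC (lim1 r k1 k2))) /\
  (* uniformity in (iii) on compact subsets of the region *)
  (forall K : R -> Prop, compact K ->
     (forall r, K r -> 2 < r /\ 1 < qq r k1 k2) ->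
     unif_cvg_on K (fun r t => seq23 r k1 k2 t) (fun r => RtoC (lim3 r))).
Proof.
  intros H12 H2; assert (H1 : (0 < k1)%nat) by lia; repeat split.
  - intros r Hr Hq; apply filterlim_C_of_Cmod; intros eps He.
    (* Pointwise convergence is the uniform estimate with [q] equal to the value of [qq] at this
       [r]. *)
    destruct (seq1_uniform k1 k2 (qq r k1 k2) H12 H2 Hq eps He) as [N HN].
    exists N; intros t Ht; apply HN; auto; lra.
  - intros r Hr Hq; apply filterlim_C_of_Cmod, seq23_critical; assumption.
  - intros r Hr Hq; apply filterlim_C_of_Cmod; intros eps He.
    destruct (seq23_tail_uniform k1 k2 (qq r k1 k2) H12 H2 Hq eps He) as [N HN].
    exists N; intros t Ht; apply HN; auto; lra.
  - intros K HK HR eps He.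
    destruct (qq_compact k1 k2 K H1 H2 HK HR) as (q & Hq & HQ).
    destruct (seq1_uniform k1 k2 q H12 H2 Hq eps He) as [N HN].
    exists N; intros t Ht r Kr; apply HN; auto; now apply HR.
  - intros K HK HR eps He.
    destruct (qq_compact_gt k1 k2 K H1 H2 HK HR) as (q & Hq & HQ).
    destruct (seq23_tail_uniform k1 k2 q H12 H2 Hq eps He) as [N HN].
    exists N; intros t Ht r Kr; apply HN; auto; now apply HR.
Qed.
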